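(* Let $(M^{2n+1},\varphi,\xi,\eta,g)$ be a trans-para-Sasakian manifold of type $(\alpha,\beta)$ such that $\varphi(\mathrm{grad}\,\alpha)=-(2n-1)\,\mathrm{grad}\,\beta$. If $M$ is conformally flat, i.e. $C=0$, then $M$ is an $\eta$-Einstein manifold.
   Context: Let $n\ge 1$ and let $M$ be a smooth manifold of dimension $2n+1$. An almost paracontact metric structure $(\varphi,\xi,\eta,g)$ on $M$ consists of a $(1,1)$-tensor field $\varphi$, a vector field $\xi$, a 1-form $\eta$ and a pseudo-Riemannian metric $g$ with $\varphi\xi=0$, $\eta\circ\varphi=0$, $\eta(\xi)=1$, $\varphi^2=\mathrm{id}-\eta\otimes\xi$, $g(\varphi X,\varphi Y)=-g(X,Y)+\eta(X)\eta(Y)$, such that $\varphi$ induces an almost paracomplex structure on $\ker\eta$ (its $\pm1$-eigendistributions there have equal rank $n$). Then $\eta(X)=g(X,\xi)$ and $g$ has signature $(n+1,n)$. Let $\nabla$ be the Levi-Civita connection of $g$. The manifold is called trans-para-Sasakian of type $(\alpha,\beta)$, where $\alpha,\beta$ are smooth functions on $M$, if for all vector fields $X,Y$ $$(\nabla_X\varphi)Y=\alpha(-g(X,Y)\xi+\eta(Y)X)+\beta(g(X,\varphi Y)\xi+\eta(Y)\varphi X).$$ Curvature: $R(X,Y)Z=\nabla_X\nabla_YZ-\nabla_Y\nabla_XZ-\nabla_{[X,Y]}Z$; $\mathrm{Ric}(Y,Z)$ is the trace of $X\mapsto R(X,Y)Z$; the Ricci operator $Q$ is given by $\mathrm{Ric}(X,Y)=g(QX,Y)$;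 $\mathrm{scal}$ is the $g$-trace of $\mathrm{Ric}$; gradients are taken with respect to $g$. The Weyl conformal tensor is $$C(X,Y)Z=R(X,Y)Z-\frac{1}{2n-1}\left(g(Y,Z)QX-g(X,Z)QY+\mathrm{Ric}(Y,Z)X-\mathrm{Ric}(X,Z)Y\right)+\frac{\mathrm{scal}}{2n(2n-1)}\left(g(Y,Z)X-g(X,Z)Y\right).$$ Here ''conformally flat'' means $C=0$. $M$ is $\eta$-Einstein if $\mathrm{Ric}=a\,g+b\,\eta\otimes\eta$ for some smooth functions $a,b$ on $M$. *)

(* Defs.v *)
From HB Require Import structures.
From mathcomp Require Import all_boot all_order all_algebra.
From mathcomp Require Import ring.
From mathcomp Require Import boolp classical_sets functions reals.
From mathcomp Require Import topology normedtype landau derive.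
Import Order.TTheory GRing.Theory Num.Theory.
Import numFieldNormedType.Exports.

Set Implicit Arguments.
Unset Strict Implicit.
Unset Printing Implicit Defensive.

Local Open Scope classical_set_scope.
Local Open Scope ring_scope.

(* A tangent vector at p is a derivation at p of the algebra of smooth         *)
(* functions, a smooth vector field is a derivation of that algebra, and a     *)
(* tensor field is a family of multilinear maps on the tangent spaces taking   *)
(* smooth vector fields to smooth values. Real-linearity of derivations is     *)
(* expressed with the constant functions cstf a, since vector fields carry     *)
(* their module structure over smooth functions.                               *)

Section EuclideanSmoothness.
Variables (R : realType) (m : nat).
Implicit Types (U : set 'rV[R]_m) (f g : 'rV[R]_m -> R).

Definition partial (i : 'I_m) f : 'rV[R]_m -> R :=
  fun x => 'D_(delta_mx 0 i) f x.

Fixpoint Ck (k : nat) U f : Prop :=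
  if k is k'.+1 then
    (forall x, U x -> differentiable f x) /\ forall i, Ck k' U (partial i f)
  else forall x, U x -> {for x, continuous f}.

Definition smooth_on U f := forall k, Ck k U f.

Lemma near_eq_differentiable f g x :
  (\forall y \near x, f y = g y) -> differentiable f x -> differentiable g x.
Proof.
move=> fg df; pose h := g - f.
have hx : h x = 0 by rewrite /h -[LHS]/(g x - f x) (nbhs_singleton fg) subrr.
pose z : {linear 'rV[R]_m -> R} := \0.
have H : h \o shift x = cst (h x) + z +o_ 0 id.
  apply/eqaddoP => e e0; near=> y.
  suff hy : h (y + x) = 0.
    rewrite -[leLHS]/`|h (y + x) - (h x + 0)| hy hx addr0 subr0 normr0.
    by rewrite mulr_ge0 // ltW.
  apply/eqP; rewrite /h -[_ (y + x)]/(g (y + x) - f (y + x)) subr_eq0 eq_sym.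
  by apply/eqP; near: y; move: fg; rewrite (near_shift 0) /= subr0.
have c0 : continuous z by move=> y; exact: cst_continuous.
have -> : g = f + h by rewrite /h addrC subrK.
apply: differentiableD => //; apply/diff_locallyP.
by have e := diff_unique c0 H; split; rewrite e.
Unshelve. all: by end_near. Qed.

Lemma CkW k U f : Ck k.+1 U f -> Ck k U f.
Proof.
elim: k f => [|k IH] f [df pf]; first by move=> x /df/differentiable_continuous.
by split=> // i; exact: IH.
Qed.

Lemma Ck_ext k U f g :
  open U -> (forall x, U x -> f x = g x) -> Ck k U f -> Ck k U g.
Proof.
move=> oU; have near_fg (f' g' : 'rV[R]_m -> R) x :
    (forall x, U x -> f' x = g' x) -> U x -> \forall y \near x, f' y = g' y.
  by move=> e Ux; apply: filterS (e) _; exact: open_nbhs_nbhs.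
elim: k f g => [|k IH] f g fg /=.
  move=> cf x Ux; rewrite /prop_for /continuous_at -fg //.
  have e := near_fg _ _ _ fg Ux.
  by apply: (cvg_trans _ (cf x Ux)); exact: near_eq_cvg e.
move=> [df pf]; split=> [x Ux|i].
  exact: near_eq_differentiable (near_fg _ _ _ fg Ux) (df x Ux).
apply: IH (pf i) => x Ux; exact: near_eq_derive (near_fg _ _ _ fg Ux).
Qed.

Lemma Ck_cst k U a : Ck k U (cst a).
Proof.
elim: k a => [|k IH] a /=; first by move=> x _; exact: cst_continuous.
split=> [x _|i]; first exact: differentiable_cst.
rewrite (_ : partial i _ = cst 0); first exact: IH.
by apply/funext => x; exact: derive_cst.
Qed.

Lemma CkB k U f g : open U -> Ck k U f -> Ck k U g -> Ck k U (f - g).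
Proof.
move=> oU; elim: k f g => [|k IH] f g /=.
  by move=> cf cg x Ux; apply: continuousB; [exact: cf|exact: cg].
move=> [df pf] [dg pg]; split=> [x Ux|i].
  by apply: differentiableB; [exact: df|exact: dg].
apply: (@Ck_ext _ _ (partial i f - partial i g)) => //; last exact: IH.
move=> x Ux; rewrite /partial deriveB //; apply: diff_derivable.
  exact: df.
exact: dg.
Qed.

Lemma CkD k U f g : open U -> Ck k U f -> Ck k U g -> Ck k U (f + g).
Proof.
move=> oU cf cg; rewrite -[g]opprK -[- g]sub0r.
by apply: CkB => //; apply: CkB => //; exact: Ck_cst.
Qed.

Lemma CkM k U f g : open U -> Ck k U f -> Ck k U g -> Ck k U (f * g).
Proof.
move=> oU; elim: k f g => [|k IH] f g.
  move=> cf cg x Ux; exact: (continuousM (cf x Ux) (cg x Ux)).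
move=> Cf Cg; have [[df pf] [dg pg]] := (Cf, Cg); split=> [x Ux|i].
  by apply: differentiableM; [exact: df|exact: dg].
apply: (@Ck_ext _ _ (f * partial i g + g * partial i f)) => //.
  move=> x Ux; rewrite /partial deriveM //; apply: diff_derivable.
    exact: df.
  exact: dg.
have [cf cg] := (CkW Cf, CkW Cg).
exact: CkD oU (IH _ _ cf (pg i)) (IH _ _ cg (pf i)).
Qed.

End EuclideanSmoothness.

Section Charts.
Variables (R : realType) (m : nat).

Record chart (M : topologicalType) := Chart {
  dom : set M;
  cod : set 'rV[R]_m;
  to_coord : M -> 'rV[R]_m;
  of_coord : 'rV[R]_m -> M;
  dom_open : open dom;
  cod_open : open cod;
  to_coord_cod : forall p, dom p -> cod (to_coord p);
  of_coord_dom : forall x, cod x -> dom (of_coord x);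
  to_coordK : forall p, dom p -> of_coord (to_coord p) = p;
  of_coordK : forall x, cod x -> to_coord (of_coord x) = x;
  to_coord_cont : forall p, dom p -> {for p, continuous to_coord};
  of_coord_cont : forall x, cod x -> {for x, continuous of_coord} }.

Record smoothManifold := SmoothManifold {
  msort :> topologicalType;
  mhausdorff : hausdorff_space msort;
  msecond_countable : @second_countable msort;
  atlas : set (chart msort);
  atlas_cover : forall p : msort, exists2 c, atlas c & dom c p;
  atlas_compat : forall c d, atlas c -> atlas d -> forall j,
    smooth_on (cod c `&` of_coord c @^-1` dom d)
      (fun x => to_coord d (of_coord c x) 0 j) }.

End Charts.

Section SmoothFunctions.
Variables (R : realType) (m : nat) (M : smoothManifold R m).

Definition is_smooth (f : M -> R) : Prop :=
  forall c, atlas c -> smooth_on (cod c) (f \o of_coord c).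

Lemma is_smooth_cst a : is_smooth (cst a).
Proof. by move=> c _ k; exact: Ck_cst. Qed.

Definition smooth_pred : {pred M -> R} := fun f => `[< is_smooth f >].

Fact smooth_pred_subring : subring_closed smooth_pred.
Proof.
split=> [|f g|f g]; rewrite !unfold_in; first exact/asboolP/is_smooth_cst.
  move=> /asboolP sf /asboolP sg; apply/asboolP => c ac k.
  by apply: CkB (sf c ac k) (sg c ac k); exact: cod_open.
move=> /asboolP sf /asboolP sg; apply/asboolP => c ac k.
by apply: CkM (sf c ac k) (sg c ac k); exact: cod_open.
Qed.
HB.instance Definition _ :=
  GRing.isSubringClosed.Build (M -> R) smooth_pred smooth_pred_subring.

Definition cinf := {f : M -> R | f \in smooth_pred}.
HB.instance Definition _ := SubChoice.on cinf.
HB.instance Definition _ := 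
  GRing.SubChoice_isSubComPzRing.Build _ _ cinf (subringClosedP _).

Definition cinf_fun (f : cinf) : M -> R := val f.
Coercion cinf_fun : cinf >-> Funclass.

Definition mkcinf (f : M -> R) (sf : is_smooth f) : cinf :=
  exist _ f (introT (asboolP _) sf).
Definition cstf (a : R) : cinf := mkcinf (is_smooth_cst a).

Lemma cinfP (f : cinf) : is_smooth f.
Proof. by have /asboolP := valP f. Qed.

Lemma cinf_ext (f g : cinf) : f =1 g -> f = g.
Proof. by move=> fg; apply: val_inj; apply/funext. Qed.

Definition point_derivation (p : M) (v : cinf -> R^o) : Prop :=
  [/\ forall f g : cinf, v (f + g) = v f + v g,
      forall (a : R) (f : cinf), v (cstf a * f) = a * v f &
      forall f g : cinf, v (f * g) = f p * v g + g p * v f].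

Definition derivation (X : cinf -> cinf^o) : Prop :=
  [/\ forall f g : cinf, X (f + g) = X f + X g,
      forall (a : R) (f : cinf), X (cstf a * f) = cstf a * X f &
      forall f g : cinf, X (f * g) = f * X g + g * X f].

Definition point_derivation_pred p : {pred cinf -> R^o} :=
  fun v => `[< point_derivation p v >].

Definition derivation_pred : {pred cinf -> cinf^o} :=
  fun X => `[< derivation X >].

Fact point_derivation_submod p : subsemimod_closed (point_derivation_pred p).
Proof.
split=> [|a v]; first split=> [|u v]; rewrite !unfold_in.
- have E f : (0 : cinf -> R^o) f = 0 by [].
  by apply/asboolP; split=> *; rewrite !E; ring.
- move=> /asboolP[uD uZ uM] /asboolP[vD vZ vM]; apply/asboolP.
  have E f : (u + v) f = u f + v f by [].
  by split=> *; rewrite !E ?(uD, uZ, uM) ?(vD, vZ, vM); ring.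
- move=> /asboolP[vD vZ vM]; apply/asboolP.
  have E f : (a *: v) f = a * v f by [].
  by split=> *; rewrite !E ?(vD, vZ, vM); ring.
Qed.
HB.instance Definition _ p := GRing.isSubmodClosed.Build R (cinf -> R^o)
  (point_derivation_pred p) (point_derivation_submod p).

Fact derivation_submod : subsemimod_closed derivation_pred.
Proof.
split=> [|a v]; first split=> [|u v]; rewrite !unfold_in.
- have E f : (0 : cinf -> cinf^o) f = 0 by [].
  by apply/asboolP; split=> *; rewrite !E ?mulr0 ?addr0.
- move=> /asboolP[uD uZ uM] /asboolP[vD vZ vM]; apply/asboolP.
  have E f : (u + v) f = u f + v f by [].
  split=> *; rewrite !E ?(uD, uZ, uM) ?(vD, vZ, vM).
  + by rewrite addrACA.
  + by rewrite mulrDr.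
  + by rewrite !mulrDr addrACA.
- move=> /asboolP[vD vZ vM]; apply/asboolP.
  have E f : (a *: v) f = a * v f by [].
  split=> *; rewrite !E ?(vD, vZ, vM).
  + by rewrite mulrDr.
  + by rewrite mulrCA.
  + by rewrite mulrDr mulrCA [X in _ + X]mulrCA.
Qed.
HB.instance Definition _ := GRing.isSubmodClosed.Build cinf (cinf -> cinf^o)
  derivation_pred derivation_submod.

Definition tangent (p : M) := {v : cinf -> R^o | v \in point_derivation_pred p}.
HB.instance Definition _ p := SubChoice.on (tangent p).
HB.instance Definition _ p :=
  GRing.SubChoice_isSubLmodule.Build _ _ _ (tangent p) (GRing.subsemimodClosedP _).

Definition vfield := {X : cinf -> cinf^o | X \in derivation_pred}.
HB.instance Definition _ := SubChoice.on vfield.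
HB.instance Definition _ :=
  GRing.SubChoice_isSubLmodule.Build _ _ _ vfield (GRing.subsemimodClosedP _).

Definition tangent_fun p (v : tangent p) : cinf -> R := val v.
Coercion tangent_fun : tangent >-> Funclass.
Definition vfield_fun (X : vfield) : cinf -> cinf := val X.
Coercion vfield_fun : vfield >-> Funclass.

Definition mkvfield (X : cinf -> cinf) (dX : derivation X) : vfield :=
  exist _ (X : cinf -> cinf^o) (introT (asboolP _) dX).

Lemma vfieldP (X : vfield) : derivation X.
Proof. by have /asboolP := valP X. Qed.

Lemma tangentP p (v : tangent p) : point_derivation p v.
Proof. by have /asboolP := valP v. Qed.

(* the value at p of a vector field *)
Fact vat_subproof (X : vfield) p : point_derivation p (fun f => X f p).
Proof.
by have [XD XZ XM] := vfieldP X; split=> *; rewrite ?(XD, XZ, XM).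
Qed.
Definition vat (X : vfield) p : tangent p :=
  exist _ (fun f => X f p : R^o) (introT (asboolP _) (vat_subproof X p)).

Fact bracket_subproof (X Y : vfield) :
  derivation (fun f => X (Y f) - Y (X f)).
Proof.
have [XD XZ XM] := vfieldP X; have [YD YZ YM] := vfieldP Y; split=> *.
- by rewrite !(XD, YD) opprD addrACA.
- by rewrite !(XZ, YZ) mulrBr.
- rewrite !(XD, YD, XM, YM); ring.
Qed.
Definition bracket (X Y : vfield) : vfield := mkvfield (bracket_subproof X Y).

End SmoothFunctions.

(* bases and dimension of a linear subspace D of V *)
Section LinearAlgebra.
Variables (R : realType) (V : lmodType R).

Definition is_basis (D : set V) (k : nat) (e : 'I_k -> V) : Prop :=
  (forall i, D (e i)) /\
  forall v, D v -> exists! c : 'rV[R]_k, v = \sum_i c 0 i *: e i.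

Definition has_dim (D : set V) (k : nat) : Prop :=
  exists e : 'I_k -> V, is_basis D e.

End LinearAlgebra.

Section TensorFields.
Variables (R : realType) (m : nat) (M : smoothManifold R m).
Implicit Types (X Y Z : vfield M) (f : cinf M).

Record oneForm := OneForm {
  form_at : forall p : M, {linear tangent p -> R^o};
  form_smooth : forall X : vfield M, is_smooth (fun p => form_at p (vat X p)) }.

Definition form_app (w : oneForm) (X : vfield M) : cinf M := mkcinf (form_smooth w X).
Coercion form_app : oneForm >-> Funclass.

Record endoField := EndoField {
  endo_at : forall p : M, {linear tangent p -> tangent p};
  endo_smooth : forall (X : vfield M) (f : cinf M),
    is_smooth (fun p => (endo_at p (vat X p) : tangent p) f) }.

Fact endo_app_subproof (A : endoField) (X : vfield M) :
  derivation (fun f => mkcinf (endo_smooth A X f)).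
Proof.
split=> *; apply: cinf_ext => p.
- by have [D _ _] := tangentP (endo_at A p (vat X p)); exact: D.
- by have [_ D _] := tangentP (endo_at A p (vat X p)); exact: D.
- by have [_ _ D] := tangentP (endo_at A p (vat X p)); exact: D.
Qed.
Definition endo_app (A : endoField) (X : vfield M) : vfield M :=
  mkvfield (endo_app_subproof A X).
Coercion endo_app : endoField >-> Funclass.

Record pseudoRiemannian := PseudoRiemannian {
  metric_at : forall p : M, tangent p -> {linear tangent p -> R^o};
  metric_sym : forall p (u v : tangent p), metric_at u v = metric_at v u;
  metric_nondeg : forall p (u : tangent p),
    (forall v, metric_at u v = 0) -> u = 0;
  metric_smooth : forall X Y : vfield M,
    is_smooth (fun p => metric_at (vat X p) (vat Y p)) }.

Definition metric_app (g : pseudoRiemannian) (X Y : vfield M) : cinf M :=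
  mkcinf (metric_smooth g X Y).
Coercion metric_app : pseudoRiemannian >-> Funclass.

Definition is_gradient (g : pseudoRiemannian) (f : cinf M) (G : vfield M) : Prop :=
  forall X, g G X = X f.

(* For every family of vector fields that is a basis of T_pM, t p is the trace of the matrix of A at p. *)
Definition is_trace (A : vfield M -> vfield M) (t : cinf M) : Prop :=
  forall (p : M) (E : 'I_m -> vfield M) (a : 'M[R]_m),
    is_basis setT (fun i => vat (E i) p) ->
    (forall j, vat (A (E j)) p = \sum_i a i j *: vat (E i) p) ->
    t p = \tr a.

(* t = g^{ij} B_{ij} in every such family. *)
Definition is_metric_trace (g : pseudoRiemannian) (B : vfield M -> vfield M -> cinf M) (t : cinf M) :
    Prop :=
  forall (p : M) (E : 'I_m -> vfield M),
    is_basis setT (fun i => vat (E i) p) ->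
    t p = \sum_i \sum_j
      invmx (\matrix_(k, l) g (E k) (E l) p) i j * B (E i) (E j) p.

End TensorFields.

Section Curvature.
Variables (R : realType) (m : nat) (M : smoothManifold R m).
Implicit Types (X Y Z : vfield M) (f : cinf M).

(* Real-linearity in the second argument follows from the Leibniz rule, as
   derivations kill constants. *)
Record connection := Connection {
  nabla :> vfield M -> vfield M -> vfield M;
  nabla_linear : forall (f : cinf M) X X' Y,
    nabla (f *: X + X') Y = f *: nabla X Y + nabla X' Y;
  nabla_additive : forall X Y Y', nabla X (Y + Y') = nabla X Y + nabla X Y';
  nabla_leibniz : forall X (f : cinf M) Y,
    nabla X (f *: Y) = X f *: Y + f *: nabla X Y }.

Definition levi_civita (g : pseudoRiemannian M) (D : connection) : Prop :=
  (forall X Y, D X Y - D Y X = bracket X Y) /\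
  (forall X Y Z, X (g Y Z) = g (D X Y) Z + g Y (D X Z)).

Definition curvature (D : connection) (X Y Z : vfield M) : vfield M :=
  D X (D Y Z) - D Y (D X Z) - D (bracket X Y) Z.

Definition is_ricci (D : connection) (Ric : vfield M -> vfield M -> cinf M) : Prop :=
  forall Y Z, is_trace (fun X => curvature D X Y Z) (Ric Y Z).

Definition is_ricci_operator (g : pseudoRiemannian M) (Ric : vfield M -> vfield M -> cinf M)
    (Q : vfield M -> vfield M) : Prop :=
  forall X Y, Ric X Y = g (Q X) Y.

End Curvature.

Section ParaContact.
Variables (R : realType) (n : nat) (M : smoothManifold R (2 * n).+1).
Implicit Types (X Y Z : vfield M) (f : cinf M).

(* The last two fields: the +1 and -1 eigendistributions of phi on ker eta,
   taken pointwise, both have rank n. The signature (n+1, n) of g is a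
   consequence of the other conditions and is not assumed. *)
Record almost_paracontact_metric (phi : endoField M) (xi : vfield M)
    (eta : oneForm M) (g : pseudoRiemannian M) : Prop := AlmostParacontactMetric {
  apm_phi_xi : phi xi = 0;
  apm_eta_phi : forall X, eta (phi X) = 0;
  apm_eta_xi : eta xi = 1;
  apm_phi2 : forall X, phi (phi X) = X - eta X *: xi;
  apm_compat : forall X Y, g (phi X) (phi Y) = - g X Y + eta X * eta Y;
  apm_dim_plus : forall p : M,
    has_dim [set v : tangent p | form_at eta p v = 0 /\ endo_at phi p v = v] n;
  apm_dim_minus : forall p : M,
    has_dim [set v : tangent p | form_at eta p v = 0 /\ endo_at phi p v = - v]
      n }.

Definition trans_para_sasakian (phi : endoField M) (xi : vfield M) (eta : oneForm M)
    (g : pseudoRiemannian M) (D : connection M) (alpha beta : cinf M) : Prop :=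
  forall X Y,
    D X (phi Y) - phi (D X Y) =
      alpha *: (- g X Y *: xi + eta Y *: X) +
      beta *: (g X (phi Y) *: xi + eta Y *: phi X).

Definition weyl (g : pseudoRiemannian M) (D : connection M) (Ric : vfield M -> vfield M -> cinf M)
    (Q : vfield M -> vfield M) (scal : cinf M) (X Y Z : vfield M) : vfield M :=
  curvature D X Y Z
  - cstf M (2 * n%:R - 1)^-1 *:
      (g Y Z *: Q X - g X Z *: Q Y + Ric Y Z *: X - Ric X Z *: Y)
  + (cstf M (2 * n%:R * (2 * n%:R - 1))^-1 * scal) *:
      (g Y Z *: X - g X Z *: Y).

Definition eta_einstein (eta : oneForm M) (g : pseudoRiemannian M)
    (Ric : vfield M -> vfield M -> cinf M) : Prop :=
  exists a b : cinf M, forall X Y, Ric X Y = a * g X Y + b * (eta X * eta Y).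

End ParaContact.

(* Main.v *)
From HB Require Import structures.
Require Import Defs.
From mathcomp Require Import all_boot all_order all_algebra.
From mathcomp Require Import ring lra.
From mathcomp Require Import boolp classical_sets functions reals.
From mathcomp Require Import topology normedtype landau derive.
From mathcomp Require Import sequences realfun exp.
From mathcomp Require Import ereal measure lebesgue_measure lebesgue_integral ftc.
Import Order.TTheory GRing.Theory Num.Theory.
Import numFieldNormedType.Exports.

Set Implicit Arguments.
Unset Strict Implicit.
Unset Printing Implicit Defensive.

Local Open Scope classical_set_scope.
Local Open Scope ring_scope.

(** The curvature identity R(X,Y)xi and its trace force everything.
Applying phi to the defining equation with Y = xi gives
  nabla_X xi = - alpha phi X - beta (X - eta(X) xi)            (nabla_xi),
and differentiating once more expresses R(X,Y)xi through alpha, beta, their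
differentials, phi and eta (curvature_xi). Its trace in X is
  Ric(Y,xi) = 2n (d beta(Y) - (alpha^2 + beta^2) eta(Y))
              - d alpha(phi Y) - d beta(Y) + eta(Y) xi(beta)   (ricci_xi),
and the condition on the gradients says exactly that
d alpha(phi Y) = (2n-1) d beta(Y), so that Ric(Y,xi) is a multiple of eta(Y)
(ricci_xi_eta). The equation C(X,xi)xi = 0 then contains the term
Ric(X,Y)/(2n-1), while every other term is a combination of g, eta (x) eta and,
through R(X,xi)xi, of g(phi X,Y). The last form is skew and Ric is symmetric
(ricciC), so its coefficient contributes nothing and Ric is a combination of g
and eta (x) eta.

Traces are evaluated in frames of vector fields, and such frames have to be
produced from the charts. A tangent vector is an abstract derivation at p, so
one needs both that coordinate fields extend to the whole manifold and that
they span T_pM. For the first, a bump function supported in a chart is built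
from exp(-1/t) (exists_bump), and functions cut off by it extend smoothly by
zero (is_smooth_zero_extension). For the second, Hadamard's lemma
f = f(x0) + sum_i (x_i - x0_i) h_i with smooth h_i (hadamard) shows that a
derivation is determined by its values on the coordinate functions. The result
is a frame E at p together with functions f_j dual to it (exists_dual_frame),
in which the trace of A is simply sum_i A(E_i)(f_i) at p. *)

(** * A smooth function flat at the origin *)

Section FlatFunction.
Variable R : realType.

(** The powers of 1/t are carried along so that the family is closed under
differentiation; [flat 0] is the usual smooth function that is flat at 0. *)
Definition flat (k : nat) (t : R) : R :=
  if 0 < t then t^-1 ^+ k * expR (- t^-1) else 0.

Lemma flat_le0 k t : t <= 0 -> flat k t = 0.
Proof. by rewrite /flat leNgt => /negbTE ->. Qed.

Lemma flat_gt0 k t : 0 < t -> 0 < flat k t.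
Proof.
by move=> t0; rewrite /flat t0 mulr_gt0 ?expR_gt0 // exprn_gt0 // invr_gt0.
Qed.

Lemma flat_ge0 k t : 0 <= flat k t.
Proof. by case: (ltP 0 t) => [/flat_gt0/ltW//|/flat_le0->]. Qed.

(** With s = 1/t this is s^(k+2) <= (k+2)! exp s, one term of the exponential
series. A quadratic bound is what makes every member of the family have
derivative 0 at 0. *)
Lemma flat_bound k t : flat k t <= (k.+2)`!%:R * t ^+ 2.
Proof.
case: (leP t 0) => [/flat_le0->|t0]; first by rewrite mulr_ge0 ?sqr_ge0.
rewrite /flat t0; set s := t^-1; have s0 : 0 < s by rewrite invr_gt0.
have : s ^+ k.+2 / (k.+2)`!%:R <= expR s.
  by apply: le_trans (expR_ge1Dxn k.+1 (ltW s0)); rewrite lerDr.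
rewrite ler_pdivrMr ?ltr0n ?fact_gt0 // => h.
rewrite expRN ler_pdivrMr ?expR_gt0 // -[in leRHS](invrK t) -/s [s^-1 ^+ 2]exprVn.
rewrite mulrAC ler_pdivlMr ?exprn_gt0 //.
by rewrite -exprD addn2 mulrC.
Qed.

Lemma is_derive_flat k (t : R) :
  is_derive t 1 (flat k) (flat k.+2 t - k%:R * flat k.+1 t).
Proof.
have [t0|t0|->] := ltgtP t 0.
- rewrite !flat_le0 ?(ltW t0) // mulr0 subr0.
  apply: (@near_eq_is_derive _ _ _ (cst 0)).
  near=> s; rewrite flat_le0 //; apply: ltW; near: s; exact: lt_nbhsl.
- pose f (s : R) := s^-1 ^+ k * expR (- s^-1).
  apply: (@near_eq_is_derive _ _ _ f).
    near=> s; have s0 : 0 < s by near: s; exact: lt_nbhsr.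
    by rewrite /flat s0.
  rewrite /flat t0.
  have tn0 : t != 0 by rewrite gt_eqF.
  have dV : is_derive t 1 (fun s : R => s^-1) (- t ^- 2).
    have := @derivableV _ _ id t 1 tn0 (@derivable_id _ _ _ _).
    move=> /derivableP; rewrite deriveV // derive_id.
    by rewrite /GRing.scale /= mulr1.
  have dE : is_derive t 1 (fun s : R => expR (- s^-1)) (t ^- 2 * expR (- t^-1)).
    have := @realfun.is_derive1_comp _ expR (fun s : R => - s^-1) t _ _
       (is_derive_expR _) (is_deriveN dV).
    by rewrite opprK mulrC.
  have dP := @is_deriveX _ _ (fun s : R => s^-1) k t 1 _ dV.
  have -> : f = (fun s : R => s^-1) ^+ k * (fun s : R => expR (- s^-1)).
    by apply/funext => s; rewrite mulrfctE exprfctE.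
  apply: (is_derive_eq (is_deriveM dP dE)).
  rewrite /GRing.scale /= exprfctE.
  by case: k {dP f} => [|k] /=; rewrite ?exprS; field; exact: tn0.
- rewrite !flat_le0 // mulr0 subr0.
  set C : R := (k.+2)`!%:R; have C0 : 0 < C by rewrite ltr0n fact_gt0.
  have lim0 : h^-1 *: (flat k (h *: 1 + 0) - flat k 0) @[h --> 0^'] --> (0 : R).
    apply/cvgrPdist_le => e e0; near=> h.
    have hn0 : h != 0 by near: h; exact: nbhs_dnbhs_neq.
    rewrite sub0r normrN addr0 [flat k 0]flat_le0 // subr0.
    rewrite /GRing.scale /= mulr1 normrM normfV ler_pdivrMl ?normr_gt0 //.
    rewrite ger0_norm ?flat_ge0 // (le_trans (flat_bound _ _)) // -/C.
    rewrite -real_normK ?num_real // expr2 mulrA mulrC ler_pM2l ?normr_gt0 //.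
    rewrite -ler_pdivlMl // mulrC; apply: ltW.
    by near: h; apply: dnbhs0_lt; rewrite divr_gt0.
  apply: DeriveDef; [by apply/cvg_ex; exists 0|exact: cvg_lim].
Unshelve. all: by end_near. Qed.

End FlatFunction.

(** * Calculus of smooth functions on Euclidean space *)

Section SmoothCalculus.
Variables (R : realType) (m : nat).
Implicit Types (U V : set 'rV[R]_m) (f g : 'rV[R]_m -> R).

Lemma Ck_setU k U V f : Ck k U f -> Ck k V f -> Ck k (U `|` V) f.
Proof.
elim: k f => [|k IH] f /= => [cU cV x [/cU|/cV]//|[dU pU] [dV pV]].
by split=> [x [/dU|/dV]//|i]; exact: IH.
Qed.

Lemma Ck_subset k U V f : U `<=` V -> Ck k V f -> Ck k U f.
Proof.
move=> UV; elim: k f => [|k IH] f /= => [c x /UV/c//|[d p]].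
by split=> [x /UV/d//|i]; exact: IH.
Qed.

Lemma Ck_sum k U (I : Type) (s : seq I) (f : I -> 'rV[R]_m -> R) : open U ->
  (forall i, Ck k U (f i)) -> Ck k U (\sum_(i <- s) f i).
Proof.
move=> oU cf; apply: (big_ind (Ck k U)) => //; first exact: (Ck_cst _ _ 0).
by move=> g h; exact: CkD.
Qed.

Lemma derive_coord (x v : 'rV[R]_m) j :
  'D_v (fun y : 'rV[R]_m => y 0 j) x = v 0 j.
Proof.
have := @derive_mx _ _ _ _ (@id 'rV[R]_m) x v (@derivable_id _ _ _ _).
by rewrite derive_id => /rowP/(_ j); rewrite mxE.
Qed.

Lemma smooth_coord U j : smooth_on U (fun y => y 0 j).
Proof.
case=> [|k] /=; first by move=> x _; exact: coord_continuous.
split=> [x _|i]; first exact: differentiable_coord.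
have -> : partial i (fun y => y 0 j) = cst ((delta_mx 0 i : 'rV[R]_m) 0 j).
  by apply/funext => x; rewrite /partial derive_coord.
exact: Ck_cst.
Qed.

Lemma differentiable_flat k (t : R) : differentiable (flat k) t.
Proof. by apply/derivable1_diffP; case: (is_derive_flat k t). Qed.

Lemma partial_flat_comp k (q : 'rV[R]_m -> R) i x : differentiable q x ->
  partial i (fun y => flat k (q y)) x =
  (flat k.+2 (q x) - k%:R * flat k.+1 (q x)) * partial i q x.
Proof.
move=> dq; have dk := differentiable_flat k (q x).
rewrite /partial deriveE; last exact: (differentiable_comp dq dk).
rewrite (diff_comp dq dk) /= diff1E // derive1E.
rewrite (@derive_val _ _ _ _ _ _ _ (is_derive_flat k (q x))).
by rewrite -deriveE // /GRing.scale /= mulrC.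
Qed.

(** The index of [flat] has to vary in the induction, since differentiating
[flat k] produces [flat k.+1] and [flat k.+2]. *)
Lemma Ck_flat_comp k l U (q : 'rV[R]_m -> R) : open U -> smooth_on U q ->
  Ck l U (fun y => flat k (q y)).
Proof.
move=> oU sq; elim: l k => [|l IH] k.
  move=> x Ux; apply: differentiable_continuous.
  apply: (@differentiable_comp _ _ _ _ q (flat k)).
    by case: (sq 1%N) => /(_ _ Ux).
  exact: differentiable_flat.
split=> [x Ux|i].
  apply: (@differentiable_comp _ _ _ _ q (flat k)).
    by case: (sq 1%N) => /(_ _ Ux).
  exact: differentiable_flat.
have [dq _] := sq 1%N; have [_ pq] := sq l.+1.
pose F := ((fun y => flat k.+2 (q y)) - cst k%:R * (fun y => flat k.+1 (q y)))
          * partial i q.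
apply: (@Ck_ext _ _ _ _ F) => // [x Ux|].
  by rewrite partial_flat_comp //; exact: dq.
apply: CkM => //; last exact: pq.
by apply: CkB => //; apply: CkM => //; exact: Ck_cst.
Qed.

End SmoothCalculus.

Section ChainRule.
Variables (R : realType) (m l : nat).
Variables (U : set 'rV[R]_m) (V : set 'rV[R]_l) (T : 'rV[R]_m -> 'rV[R]_l).
Hypothesis sT : forall j, smooth_on U (fun x => T x 0 j).
Hypothesis TV : forall x, U x -> V (T x).
Hypothesis oU : open U.

Lemma differentiable_row x :
  (forall j, differentiable (fun x => T x 0 j) x) -> differentiable T x.
Proof.
move=> dT.
have -> : T = \sum_j (fun y => T y 0 j *: delta_mx 0 j).
  by apply/funext => y; rewrite fct_sumE; exact: row_sum_delta.
by apply: differentiable_sum => j; exact: differentiableZl.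
Qed.

Let dT x : U x -> differentiable T x.
Proof.
by move=> Ux; apply: differentiable_row => j; have [/(_ _ Ux)] := sT j 1%N.
Qed.

Lemma partial_comp (f : 'rV[R]_l -> R) i x : U x -> differentiable f (T x) ->
  partial i (f \o T) x =
  \sum_j partial j f (T x) * partial i (fun y => T y 0 j) x.
Proof.
move=> Ux df; rewrite /partial deriveE; last first.
  exact: differentiable_comp (dT Ux) df.
rewrite diff_comp //=; last exact: dT.
rewrite -(deriveE _ (dT Ux)) derive_mx; last exact: diff_derivable (dT Ux).
rewrite [X in 'd f _ X]row_sum_delta linear_sum; apply: eq_bigr => j _.
by rewrite linearZ /= -deriveE // mxE mulrC.
Qed.

(** Induction on k: each partial derivative of the composition is a sum of
products of a partial derivative of f composed with T and a partial derivative
of a coordinate of T. *)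
Lemma Ck_comp k (f : 'rV[R]_l -> R) : open V -> Ck k V f -> Ck k U (f \o T).
Proof.
move=> oV; elim: k f => [|k IH] f.
  move=> cf x Ux; apply: continuous_comp; last exact/cf/TV.
  exact/differentiable_continuous/dT.
move=> [df pf]; split=> [x Ux|i].
  by apply: differentiable_comp; [exact: dT|exact/df/TV].
pose F := \sum_j (partial j f \o T) * partial i (fun y => T y 0 j).
apply: (@Ck_ext _ _ _ _ F) => // [x Ux|].
  by rewrite partial_comp //; [rewrite /F fct_sumE|exact/df/TV].
apply: Ck_sum => // j; apply: CkM => //; first exact: IH (pf j).
by have [_ p] := sT j k.+1; exact: p.
Qed.

End ChainRule.

(** * Integration over the unit interval *)

Section MeanOverUnitInterval.
Variable R : realType.
Implicit Types (u v : R -> R) (t : R).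

Definition mean01 u : R := \int[lebesgue_measure]_(t in `[0, 1]) u t.

Definition continuous01 u := forall t, 0 <= t <= 1 -> {for t, continuous u}.

Lemma continuous01_within u : continuous01 u -> {within `[0, 1], continuous u}.
Proof.
move=> cu; apply: continuous_in_subspaceT => t.
by rewrite inE /= in_itv /=; exact: cu.
Qed.

Lemma continuous01_integrable u : continuous01 u ->
  lebesgue_measure.-integrable `[0, 1] (EFin \o u).
Proof.
move=> cu; apply: continuous_compact_integrable; first exact: segment_compact.
exact: continuous01_within.
Qed.

Lemma mean01B u v : continuous01 u -> continuous01 v ->
  mean01 (fun t => u t - v t) = mean01 u - mean01 v.
Proof. by move=> cu cv; apply: RintegralB => //; exact: continuous01_integrable. Qed.

Lemma mean01Zr u (a : R) : continuous01 u ->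
  mean01 (fun t => u t * a) = mean01 u * a.
Proof. by move=> cu; apply: RintegralZr => //; exact: continuous01_integrable. Qed.

Lemma continuous01_sum n (u : 'I_n -> R -> R) :
  (forall i, continuous01 (u i)) -> continuous01 (fun t => \sum_i u i t).
Proof.
move=> cu t t01; rewrite -fct_sumE; elim/big_ind: _ => [||i _].
- exact: cst_continuous.
- by move=> v w cv cw; exact: continuousD.
- exact: cu.
Qed.

Lemma mean01_sum n (u : 'I_n -> R -> R) : (forall i, continuous01 (u i)) ->
  mean01 (fun t => \sum_i u i t) = \sum_i mean01 (u i).
Proof.
elim: n u => [|n IH] u cu.
  rewrite big_ord0 /mean01; under eq_Rintegral do rewrite big_ord0.
  by rewrite Rintegral_cst // mul0r.
rewrite big_ord_recl -IH // /mean01.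
under eq_Rintegral do rewrite big_ord_recl.
rewrite RintegralD //; first exact: continuous01_integrable.
by apply: continuous01_integrable; exact: continuous01_sum.
Qed.

Lemma mean01_cst (a : R) : mean01 (cst a) = a.
Proof.
have l1 := @lebesgue_measure_itv R `[0, 1]%R.
rewrite /mean01 Rintegral_cst // [fine _](congr1 fine l1) /= lte01.
by rewrite oppr0 addr0 mulr1.
Qed.

Lemma mean01_norm_le u (e : R) : continuous01 u ->
  (forall t, 0 <= t <= 1 -> `|u t| <= e) -> `|mean01 u| <= e.
Proof.
move=> cu ue; have ce : continuous01 (cst e) by move=> t _; exact: cst_continuous.
apply: le_trans (le_normr_Rintegral _ (continuous01_integrable cu)) _ => //.
rewrite -[leRHS]mean01_cst; apply: le_Rintegral => //.
- apply: (@continuous01_integrable (fun t => `|u t|)) => t t01.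
  exact: continuous_comp (cu t t01) (@norm_continuous _ R _).
- exact: continuous01_integrable.
Qed.

Lemma mean01_derive (f u : R -> R) : continuous01 u ->
  (forall t, 0 <= t <= 1 -> is_derive t 1 f (u t)) -> mean01 u = f 1 - f 0.
Proof.
move=> cu fu; have cf : continuous01 f.
  by move=> t /fu[df _]; exact/differentiable_continuous/derivable1_diffP.
rewrite /mean01 /Rintegral (@continuous_FTC2 _ u f) //.
- exact: continuous01_within.
- split.
  + by move=> t; rewrite in_itv /= => /andP[t0 t1]; have [] := fu t; rewrite ?ltW.
  + by apply: cvg_at_right_filter; apply: cf; rewrite lexx ler01.
  + by apply: cvg_at_left_filter; apply: cf; rewrite lexx ler01.
- move=> t; rewrite in_itv /= => /andP[t0 t1]; rewrite derive1E.
  by have [] := fu t; rewrite ?ltW.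
Qed.

End MeanOverUnitInterval.

(** * Hadamard's lemma *)

Lemma differentiable_expansion (R : numFieldType) (V W : normedModType R)
    (f : V -> W) x (L : {linear V -> W}) : continuous L ->
  (forall e : R, 0 < e -> \forall y \near x,
     `|f y - f x - L (y - x)| <= e * `|y - x|) ->
  differentiable f x /\ 'd f x = L :> (V -> W).
Proof.
move=> cL fL.
have fo : f \o shift x = cst (f x) + L +o_ 0 id.
  apply/eqaddoP => e e0; near=> h.
  rewrite -[leLHS]/`|f (h + x) - (f x + L h)| opprD addrA.
  suff : `|f (h + x) - f x - L (h + x - x)| <= e * `|h + x - x| by rewrite addrK.
  by near: h; have := fL e e0; rewrite (near_shift 0) /= subr0.
have dE := diff_unique cL fo.
by split=> //; apply/diff_locallyP; split; rewrite dE.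
Unshelve. all: by end_near. Qed.

Section Hadamard.
Variables (R : realType) (m : nat).
Implicit Types (f : 'rV[R]_m -> R) (x y u v : 'rV[R]_m).

(** Lets one read off the partial derivatives together with differentiability
from a single first-order estimate. *)
Lemma differentiable_approx f x (a : 'I_m -> R) :
  (forall e : R, 0 < e -> \forall y \near x,
     `|f y - f x - \sum_i a i * (y - x) 0 i| <= e * `|y - x|) ->
  differentiable f x /\ forall i, partial i f x = a i.
Proof.
move=> fa; pose L (v : 'rV[R]_m) : R := \sum_i a i * v 0 i.
have Llin : linear L.
  move=> c u v; rewrite /L scaler_sumr -big_split; apply: eq_bigr => i _ /=.
  by rewrite !mxE mulrDr /GRing.scale /= mulrCA.
pose Lm := GRing.isLinear.Build _ _ _ _ L Llin.
pose LL : {linear 'rV[R]_m -> R} := HB.pack L Lm.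
have cL : continuous LL.
  move=> v; rewrite /LL /= /L -fct_sumE; elim/big_ind: _ => [||i _].
  - exact: cst_continuous.
  - by move=> v' w cv cw; exact: continuousD.
  - by apply: continuousM; [exact: cst_continuous|exact: coord_continuous].
have [df dE] := differentiable_expansion cL fa.
split=> // i; rewrite /partial deriveE // dE /= /L (bigD1 i) //= big1.
  by rewrite mxE !eqxx mulr1 addr0.
by move=> j ji; rewrite mxE (negbTE ji) andbF mulr0.
Qed.

Lemma is_derive_line f u v (t : R) : differentiable f (u + t *: v) ->
  is_derive t 1 (fun s : R => f (u + s *: v))
    (\sum_i partial i f (u + t *: v) * v 0 i).
Proof.
move=> df; pose l (s : R) := u + s *: v.
have dl : is_diff t l ( *:%R^~ v).
  have -> : *:%R^~ v = 0 + *:%R^~ v :> (R -> 'rV[R]_m) by rewrite add0r.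
  exact: is_diffD.
have dfl : differentiable (f \o l) t by apply: differentiable_comp.
apply: DeriveDef; first exact/derivable1_diffP.
rewrite deriveE // diff_comp // [X in _ \o X](@diff_val _ _ _ _ _ _ _ dl) /=.
rewrite scale1r [X in 'd f _ X]row_sum_delta linear_sum; apply: eq_bigr => i _.
by rewrite linearZ /= /partial deriveE // mulrC.
Qed.

Lemma mean_value_line f u w :
  (forall t : R, 0 <= t <= 1 -> differentiable f (u + t *: (w - u))) ->
  exists2 t : R, 0 <= t <= 1 &
    f w - f u = \sum_i partial i f (u + t *: (w - u)) * (w - u) 0 i.
Proof.
move=> df; pose F (s : R) := f (u + s *: (w - u)).
have t01 (t : R) : t \in `]0, 1[%R -> 0 <= t <= 1.
  by rewrite in_itv /= => /andP[t0 t1]; rewrite !ltW.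
have [|t] := MVT ltr01 (fun t t0 => is_derive_line (df t (t01 t t0))).
  apply: continuous01_within => t /df dft.
  have [d _] := is_derive_line dft.
  exact/differentiable_continuous/derivable1_diffP.
move=> /t01 ht; rewrite /F scale1r scale0r addr0 subr0 mulr1 subrKC => ->.
by exists t.
Qed.

Lemma ball_segment (c : 'rV[R]_m) (r t : R) x : 0 <= t <= 1 ->
  ball c r x -> ball c r (c + t *: (x - c)).
Proof.
move=> /andP[t0 t1]; rewrite -ball_normE /=.
rewrite opprD addNKr normrN normrZ ger0_norm // distrC; apply: le_lt_trans.
by rewrite ler_piMl.
Qed.

Lemma ler_norm_coord v i : `|v 0 i| <= `|v|.
Proof.
by rewrite [leRHS]/Num.Def.normr /= mx_normrE; exact: (le_bigmax _ _ (0, i)).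
Qed.

Variables (x0 : 'rV[R]_m) (r : R).
Let U := ball x0 r.
Let line (t : R) x := x0 + t *: (x - x0).

Let lineU (t : R) x : 0 <= t <= 1 -> U x -> U (line t x).
Proof. exact: ball_segment. Qed.

Let oU : open U. Proof. exact: ball_open. Qed.

Lemma continuous_line f x : (forall y, U y -> {for y, continuous f}) -> U x ->
  continuous01 (fun t => f (line t x)).
Proof.
move=> cf Ux t t01; apply: (@continuous_comp _ _ _ (line ^~ x) f).
  apply: continuousD; first exact: cst_continuous.
  exact: continuousZr_tmp.
exact/cf/lineU.
Qed.

(** Uniformity in t comes from compactness of [0, 1] (the tube lemma). *)
Lemma near_line f x (e : R) : (forall y, U y -> {for y, continuous f}) -> U x ->
  0 < e -> \forall y \near x, forall t, 0 <= t <= 1 ->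
    `|f (line t y) - f (line t x)| <= e.
Proof.
move=> cf Ux e0.
have joint (t : R) : 0 <= t <= 1 ->
    \forall z \near (t, x), `|f (line t x) - f (line z.1 z.2)| <= e / 2.
  move=> t01; have : {for (t, x), continuous (fun z => f (line z.1 z.2))}.
    apply: (@continuous_comp _ _ _ (fun z => line z.1 z.2) f).
      apply: continuousD; first exact: cst_continuous.
      apply: continuousZ; first exact: cvg_fst.
      by apply: continuousB; [exact: cvg_snd|exact: cst_continuous].
    exact/cf/lineU.
  by move/cvgrPdist_le => /(_ (e / 2)); apply; rewrite divr_gt0.
pose P y t := `|f (line t y) - f (line t x)| <= e.
have H : (\forall y \near x, `[0, 1] `<=` P y).
  apply: ((compact_near_coveringP _).1 (@segment_compact R 0 1) _ (nbhs x) P).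
  move=> t; rewrite /= in_itv /= => /joint[[A B] /= [At Bx] AB].
  exists (A, B) => // -[t' y] /= [At' By]; rewrite /P.
  have h1 : `|f (line t x) - f (line t' y)| <= e / 2 by exact: (AB (t', y)).
  have h2 : `|f (line t x) - f (line t' x)| <= e / 2.
    by apply: (AB (t', x)); split => //; exact: nbhs_singleton.
  rewrite -(subrKA (f (line t x))) (le_trans (ler_normD _ _)) //.
  by rewrite [leRHS]splitr lerD // distrC.
by apply: filterS H => y h t t01; apply: h; rewrite /= in_itv.
Qed.

(** The weight t^s appears because each derivative in x of f(x0 + t(x - x0))
produces a factor t, so that partial derivatives of averages are again averages. *)
Definition average (s : nat) f x : R := mean01 (fun t => t ^+ s * f (line t x)).

Lemma continuous_weighted_line s f x : (forall y, U y -> {for y, continuous f}) ->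
  U x -> continuous01 (fun t => t ^+ s * f (line t x)).
Proof.
move=> cf Ux t t01; apply: continuousM; last exact: continuous_line t01.
exact: exprn_continuous.
Qed.

Lemma weight_le1 s (t : R) : 0 <= t <= 1 -> `|t ^+ s| <= 1.
Proof. by move=> /andP[t0 t1]; rewrite ger0_norm ?exprn_ge0 // exprn_ile1. Qed.

Lemma continuous_average s f x : (forall y, U y -> {for y, continuous f}) ->
  U x -> {for x, continuous (average s f)}.
Proof.
move=> cf Ux; rewrite /prop_for /continuous_at.
apply/(@cvgrPdist_le _ _ _ (nbhs x)) => e e0.
have nU : nbhs x U by exact: open_nbhs_nbhs.
apply: (@filterS _ (nbhs x)) (filterI nU (near_line cf Ux e0)) => y [Uy ye].
rewrite /average -mean01B; try exact: continuous_weighted_line.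
apply: mean01_norm_le => [|t t01].
  move=> t t01; apply: continuousB; exact: continuous_weighted_line t01.
rewrite -mulrBr normrM distrC -[leRHS]mul1r ler_pM ?weight_le1 //.
exact: ye.
Qed.

(** Differentiation under the integral sign, as a total derivative: the mean
value theorem on the segment between the images of x and y under the
homothety bounds the first-order error at each t by the oscillation of the
partial derivatives, which is uniformly small by [near_line]. *)
Lemma average_partial s f x : (forall y, U y -> differentiable f y) ->
  (forall i y, U y -> {for y, continuous (partial i f)}) -> U x ->
  differentiable (average s f) x /\
  forall i, partial i (average s f) x = average s.+1 (partial i f) x.
Proof.
move=> df cpf Ux; apply: differentiable_approx => e e0.
have cf y : U y -> {for y, continuous f} by move/df/differentiable_continuous.
pose e1 := e / m.+1%:R; have e10 : 0 < e1 by rewrite divr_gt0 // ltr0n.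
have : \forall y \near x, U y /\ forall i t, 0 <= t <= 1 ->
    `|partial i f (line t y) - partial i f (line t x)| <= e1.
  apply: filterI; first exact: open_nbhs_nbhs.
  by apply: (@filter_forall _ _ _ (nbhs x)) => i; exact: near_line (@cpf i) Ux e10.
move=> /nbhs_ballP[d /= d0 xd]; apply/nbhs_ballP; exists d => //= y xdy.
have [Uy _] := xd y xdy; set v := y - x.
have cwi i : continuous01 (fun t => t ^+ s.+1 * partial i f (line t x)).
  by apply: continuous_weighted_line => //; exact: cpf.
have cwi' i : continuous01 (fun t => t ^+ s.+1 * partial i f (line t x) * v 0 i).
  by move=> t t01; apply: continuousM; [exact: cwi|exact: cst_continuous].
have cw := continuous01_sum cwi'.
have sumE : \sum_i average s.+1 (partial i f) x * v 0 i =
    mean01 (fun t => \sum_i t ^+ s.+1 * partial i f (line t x) * v 0 i).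
  by rewrite mean01_sum //; apply: eq_bigr => i _; rewrite mean01Zr.
have cwf z : U z -> continuous01 (fun t => t ^+ s * f (line t z)).
  by move=> Uz; exact: continuous_weighted_line.
have cd : continuous01 (fun t => t ^+ s * f (line t y) - t ^+ s * f (line t x)).
  move=> t t01; apply: continuousB; exact: cwf.
rewrite sumE /average -mean01B; try exact: cwf.
rewrite -mean01B //; apply: mean01_norm_le => [|t t01].
  by move=> t t01; apply: continuousB; [exact: cd|exact: cw].
have segE (a : R) : line t x + a *: (line t y - line t x) = line t (x + a *: v).
  rewrite /line /v; apply/rowP => i; rewrite !mxE; ring.
have xda (a : R) : 0 <= a <= 1 -> ball x d (x + a *: v).
  by move=> a01; exact: ball_segment.
have [a a01] : exists2 a : R, 0 <= a <= 1 &
    f (line t y) - f (line t x) =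
    \sum_i partial i f (line t (x + a *: v)) * (line t y - line t x) 0 i.
  have [a a01|a a01 e2] := @mean_value_line f (line t x) (line t y).
    by rewrite segE; apply/df/lineU => //; have [] := xd _ (xda a a01).
  by exists a; rewrite // e2 segE.
rewrite -mulrBr => ->; rewrite mulr_sumr -sumrB.
have [_ pe] := xd _ (xda a a01).
apply: (@le_trans _ _ (\sum_(i < m) e1 * `|v|)).
  apply: le_trans (ler_norm_sum _ _ _) _; apply: ler_sum => i _.
  have -> : (line t y - line t x) 0 i = t * v 0 i.
    by rewrite /line /v !mxE; ring.
  have -> :
      t ^+ s * (partial i f (line t (x + a *: v)) * (t * v 0 i)) -
      t ^+ s.+1 * partial i f (line t x) * v 0 i =
      t ^+ s.+1 *
      ((partial i f (line t (x + a *: v)) - partial i f (line t x)) * v 0 i).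
    by rewrite exprS; ring.
  rewrite normrM -[leRHS]mul1r ler_pM ?weight_le1 // normrM.
  by rewrite ler_pM ?ler_norm_coord // pe.
rewrite sumr_const card_ord -mulr_natr mulrAC ler_wpM2r //.
by rewrite /e1 -mulrA ger_pMr // ler_pdivrMl ?ltr0n // mulr1 ler_nat.
Qed.

Lemma Ck_le k l V f : (k <= l)%N -> Ck l V f -> Ck k V f.
Proof.
elim: l => [|l IH]; first by rewrite leqn0 => /eqP ->.
by rewrite leq_eqVlt => /predU1P[->//|kl] /CkW; exact: IH.
Qed.

Lemma Ck_average k s f : Ck k U f -> Ck k U (average s f).
Proof.
elim: k s f => [|k IH] s f; first by move=> cf x Ux; exact: continuous_average.
move=> cf; have [df pf] := cf.
have cpf i y : U y -> {for y, continuous (partial i f)}.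
  by have := Ck_le (leq0n k) (pf i); exact.
split=> [x Ux|i]; first by have [] := average_partial s df cpf Ux.
apply: (@Ck_ext _ _ _ _ (average s.+1 (partial i f))) => // [x Ux|]; last first.
  exact: IH (pf i).
by have [_ ->] := average_partial s df cpf Ux.
Qed.

(** The fundamental theorem of calculus along the segment from x0 to x; the
coefficients are the averages of the partial derivatives along it. *)
Lemma hadamard f : smooth_on U f -> exists h : 'I_m -> 'rV[R]_m -> R,
  (forall i, smooth_on U (h i)) /\
  forall x, U x -> f x = f x0 + \sum_i (x 0 i - x0 0 i) * h i x.
Proof.
move=> sf; have [df _] := sf 1%N.
have pc i y : U y -> {for y, continuous (partial i f)}.
  by have [_ pf] := sf 1%N; exact: pf.
exists (fun i => average 0 (partial i f)); split=> [i k|x Ux].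
  by apply: Ck_average; have [_ pf] := sf k.+1; exact: pf.
have ci i : continuous01 (fun t => t ^+ 0 * partial i f (line t x) * (x - x0) 0 i).
  move=> t t01; apply: continuousM; last exact: cst_continuous.
  by apply: continuous_weighted_line t01 => //; exact: pc.
apply/eqP; rewrite addrC -subr_eq; apply/eqP.
have lE : mean01 (fun t => \sum_i t ^+ 0 * partial i f (line t x) * (x - x0) 0 i)
    = f x - f x0.
  have := @mean01_derive _ (fun t => f (line t x)) _ (continuous01_sum ci).
  rewrite /line scale1r scale0r addr0 subrKC; apply=> t t01.
  apply: is_derive_eq (is_derive_line (df _ (lineU t01 Ux))) _.
  by apply: eq_bigr => i _; rewrite expr0 mul1r.
rewrite -lE mean01_sum //; apply: eq_bigr => i _.
rewrite mean01Zr ?mxE 1?mulrC //; apply: continuous_weighted_line => //; exact: pc.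
Qed.

End Hadamard.

(** * Bump functions and extension by zero *)

Section Bump.
Variables (R : realType) (m : nat).

(** [flat 0] applied to r^2 - |x - x0|^2; its support lies in the cube of
half-side r, which is compact. *)
Lemma exists_bump (U : set 'rV[R]_m) (x0 : 'rV[R]_m) : open U -> U x0 ->
  exists (psi : 'rV[R]_m -> R) (K : set 'rV[R]_m),
    [/\ smooth_on setT psi, 0 < psi x0, compact K, K `<=` U &
        forall x, ~ K x -> psi x = 0].
Proof.
move=> oU Ux0; have /nbhs_ballP[e /= e0 eU] : nbhs x0 U by exact: open_nbhs_nbhs.
pose r := e / 2; have r0 : 0 < r by rewrite divr_gt0.
pose q := cst (r ^+ 2) - \sum_j ((fun x : 'rV[R]_m => x 0 j) - cst (x0 0 j)) *
                               ((fun x : 'rV[R]_m => x 0 j) - cst (x0 0 j)).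
have qE x : q x = r ^+ 2 - \sum_j (x 0 j - x0 0 j) ^+ 2.
  by rewrite /q -[LHS]/(r ^+ 2 - (\sum_j _) x) fct_sumE.
have sq : smooth_on setT q.
  move=> k; apply: CkB; [exact: openT|exact: Ck_cst|].
  apply: Ck_sum => [|j]; first exact: openT.
  by apply: CkM; try exact: openT; apply: CkB; try exact: openT;
    try exact: Ck_cst; exact: smooth_coord.
pose K := [set v : 'rV[R]_m | forall j, `[x0 0 j - r, x0 0 j + r]%classic (v 0 j)].
exists (fun x => flat 0 (q x)), K; split.
- by move=> k; apply: Ck_flat_comp => //; exact: openT.
- apply: flat_gt0; rewrite qE big1 ?subr0 ?exprn_gt0 // => j _.
  by rewrite subrr expr0n.
- apply: (@rV_compact R m (fun j => `[x0 0 j - r, x0 0 j + r]%classic)) => j.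
  exact: segment_compact.
- move=> v Kv; apply: eU; split=> // i j; rewrite ord1 /ball /=.
  have := Kv j; rewrite /= in_itv /= => /andP[h1 h2].
  have re : r < e by rewrite /r ltr_pdivrMr // mulr_natr mulr2n ltrDl.
  by rewrite ltr_norml; apply/andP; split; lra.
- move=> x nK; apply: flat_le0; rewrite leNgt; apply/negP => q0; apply: nK => j.
  have : (x 0 j - x0 0 j) ^+ 2 < r ^+ 2.
    move: q0; rewrite qE subr_gt0; apply: le_lt_trans.
    by rewrite (bigD1 j) //= lerDl sumr_ge0 // => i _; exact: sqr_ge0.
  by rewrite /= in_itv /= => h; apply/andP; split; nra.
Qed.

End Bump.

Section ExtensionByZero.
Variables (R : realType) (m : nat) (M : smoothManifold R m).

Definition zero_extension (c : chart R m M) (h : 'rV[R]_m -> R) : M -> R :=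
  fun q => if `[< dom c q >] then h (to_coord c q) else 0.

Lemma zero_extension_dom c h q : dom c q ->
  zero_extension c h q = h (to_coord c q).
Proof. by rewrite /zero_extension => /asboolP ->. Qed.

Lemma open_preimage_on (S T : topologicalType) (f : S -> T) A B :
  open A -> open B -> (forall x, A x -> {for x, continuous f}) ->
  open (A `&` f @^-1` B).
Proof.
move=> oA oB cf; rewrite openE => x [Ax Bfx]; apply: filterI.
  exact: open_nbhs_nbhs.
by apply: (cf x Ax); exact: open_nbhs_nbhs.
Qed.

(** In any other chart the domain is covered by two open sets: the part meeting
the domain of c, where one composes with the transition map, and the complement
of the image of K, where the extension vanishes. The latter is open because
a compact subset of a Hausdorff space is closed. *)
Lemma is_smooth_zero_extension (c : chart R m M) h K : atlas c ->
  smooth_on (cod c) h -> compact K -> K `<=` cod c ->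
  (forall x, ~ K x -> h x = 0) -> is_smooth (zero_extension c h).
Proof.
move=> ac sh cK Kc h0 d ad k.
pose K' := of_coord c @` K.
have clK' : closed K'.
  apply: compact_closed; first exact: mhausdorff.
  apply: continuous_compact cK; apply: continuous_in_subspaceT => x.
  by rewrite inE => /Kc; exact: of_coord_cont.
pose T x := to_coord c (of_coord d x).
pose U1 := cod d `&` of_coord d @^-1` dom c.
pose U2 := cod d `&` of_coord d @^-1` (~` K').
have oU1 : open U1.
  apply: open_preimage_on (@of_coord_cont _ _ _ d); first exact: cod_open.
  exact: dom_open.
have oU2 : open U2.
  apply: open_preimage_on (@of_coord_cont _ _ _ d); first exact: cod_open.
  by rewrite openC.
apply: (@Ck_subset _ _ _ _ (U1 `|` U2)).
  move=> y cy; have [dy|ndy] := pselect (dom c (of_coord d y)); first by left.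
  right; split=> // -[x /Kc cx xy]; apply: ndy.
  by rewrite -xy; exact: of_coord_dom.
apply: Ck_setU.
- apply: (@Ck_ext _ _ _ _ (h \o T)) => // [y [_ dy]|].
    by rewrite /= zero_extension_dom.
  apply: (@Ck_comp _ _ _ _ (cod c)) => //; last exact: cod_open.
    by move=> j; exact: (atlas_compat ad ac).
  by move=> y [_ dy]; exact: to_coord_cod.
- apply: (@Ck_ext _ _ _ _ (cst 0)) => // [y [_ nK]|]; last exact: Ck_cst.
  rewrite /= /zero_extension; case: asboolP => // dy.
  rewrite h0 // => Kx; apply: nK; exists (to_coord c (of_coord d y)) => //.
  exact: to_coordK.
Qed.

End ExtensionByZero.

(** * Coordinate vector fields and frames *)

Section VectorFieldValues.
Variables (R : realType) (m : nat) (M : smoothManifold R m).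

Lemma vfield_ext (X Y : vfield M) : (forall f, X f = Y f) -> X = Y.
Proof. by move=> XY; apply: val_inj; apply/funext. Qed.

Lemma tangent_ext (p : M) (u v : tangent p) : (forall f, u f = v f) -> u = v.
Proof. by move=> uv; apply: val_inj; apply/funext. Qed.

Lemma vfieldDE (X Y : vfield M) f : (X + Y : vfield M) f = X f + Y f.
Proof. by []. Qed.

Lemma vfieldNE (X : vfield M) f : (- X : vfield M) f = - X f.
Proof. by []. Qed.

Lemma vfieldZE (a : cinf M) (X : vfield M) f : (a *: X : vfield M) f = a * X f.
Proof. by []. Qed.

Lemma vatD (p : M) (X Y : vfield M) : vat (X + Y) p = vat X p + vat Y p.
Proof. exact: tangent_ext. Qed.

Lemma vatZ (p : M) (a : cinf M) (X : vfield M) :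
  vat (a *: X) p = a p *: vat X p.
Proof. exact: tangent_ext. Qed.

Lemma tangent_sum (p : M) (I : Type) (s : seq I) (v : I -> tangent p) f :
  (\sum_(i <- s) v i : tangent p) f = \sum_(i <- s) v i f.
Proof. by elim/big_rec2: _ => // i y1 y2 _ <-. Qed.

End VectorFieldValues.

Section CoordinateFields.
Variables (R : realType) (m : nat) (M : smoothManifold R m).
Variables (c : chart R m M) (ac : atlas c).
Variables (psi : 'rV[R]_m -> R) (K U : set 'rV[R]_m).
Hypotheses (spsi : smooth_on setT psi) (cK : compact K).
Hypotheses (psi0 : forall x, ~ K x -> psi x = 0) (KU : K `<=` U).
Hypotheses (oU : open U) (Uc : U `<=` cod c).

Lemma is_smooth_cutoff h : smooth_on U h ->
  is_smooth (zero_extension c (psi * h)).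
Proof.
move=> sh; apply: (is_smooth_zero_extension ac _ cK) => [k|x /KU/Uc//|x nK].
  apply: (@Ck_subset _ _ _ _ (U `|` ~` K)).
    by move=> x _; have [/KU|] := pselect (K x); [left|right].
  apply: Ck_setU.
    by apply: CkM (sh k) => //; exact: Ck_subset (spsi k).
  have oK : open (~` K).
    by rewrite openC; apply: compact_closed cK; exact: norm_hausdorff.
  apply: (Ck_ext oK _ (Ck_cst k (~` K) 0)) => x nK.
  by rewrite mulrfctE psi0 // mul0r.
by rewrite mulrfctE psi0 // mul0r.
Qed.

Definition cutoff h (sh : smooth_on U h) : cinf M := mkcinf (is_smooth_cutoff sh).

Lemma cutoff_dom h (sh : smooth_on U h) q : dom c q ->
  cutoff sh q = psi (to_coord c q) * h (to_coord c q).
Proof. exact: zero_extension_dom. Qed.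

Lemma cutoff_out h (sh : smooth_on U h) q : ~ dom c q -> cutoff sh q = 0.
Proof.
move=> nd; rewrite -[LHS]/(zero_extension _ _ q) /zero_extension.
by case: asboolP.
Qed.

Lemma smooth_on_chart (f : cinf M) : smooth_on U (f \o of_coord c).
Proof. by move=> k; apply: Ck_subset Uc _; exact: cinfP. Qed.

Lemma smooth_partial i (f : cinf M) : smooth_on U (partial i (f \o of_coord c)).
Proof. by move=> k; have [_ pf] := smooth_on_chart f k.+1; exact: pf. Qed.

Lemma cutoff_partial_derivation i :
  derivation (fun f => cutoff (smooth_partial i f)).
Proof.
have df (f : cinf M) x : cod c x -> derivable (f \o of_coord c) x (delta_mx 0 i).
  move=> cx; apply: diff_derivable.
  by have [d _] := cinfP f ac 1%N; exact: d.
split=> [f g|a f|f g]; apply: cinf_ext => q.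
- rewrite -[RHS]/(zero_extension _ _ q + zero_extension _ _ q).
  rewrite -[LHS]/(zero_extension _ _ q) /zero_extension.
  case: asboolP => [dq|_]; last by rewrite addr0.
  have cx := to_coord_cod dq; rewrite !mulrfctE -mulrDr; congr (_ * _).
  by rewrite /partial -deriveD //; exact: df.
- rewrite -[RHS]/(a * zero_extension _ _ q).
  rewrite -[LHS]/(zero_extension _ _ q) /zero_extension.
  case: asboolP => [dq|_]; last by rewrite mulr0.
  have cx := to_coord_cod dq; rewrite !mulrfctE mulrCA; congr (_ * _).
  by rewrite /partial -[RHS]deriveZ //; exact: df.
- rewrite -[RHS]/(f q * zero_extension _ _ q + g q * zero_extension _ _ q).
  rewrite -[LHS]/(zero_extension _ _ q) /zero_extension.
  case: asboolP => [dq|_]; last by rewrite !mulr0 addr0.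
  have cx := to_coord_cod dq; rewrite !mulrfctE.
  have qE (h : cinf M) : h q = (h \o of_coord c) (to_coord c q).
    by rewrite /= to_coordK.
  rewrite mulrCA [X in _ + X]mulrCA -mulrDr; congr (_ * _).
  by rewrite !qE; exact: (deriveM (df f _ cx) (df g _ cx)).
Qed.

(** A coordinate field, damped so as to be defined on all of M. *)
Definition cutoff_partial i : vfield M := mkvfield (cutoff_partial_derivation i).

Variables (p : M) (dp : dom c p).

Lemma smooth_centered_coord j :
  smooth_on U (fun x => x 0 j - to_coord c p 0 j).
Proof.
move=> k; apply: (@CkB _ _ _ _ (fun x => x 0 j) (cst _)) => //.
  exact: smooth_coord.
exact: Ck_cst.
Qed.

(** One factor psi comes from the field and one from the function; the term
with the derivative of psi drops out because the coordinate is centered at p. *)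
Lemma cutoff_partial_coord i j :
  cutoff_partial i (cutoff (smooth_centered_coord j)) p =
  psi (to_coord c p) ^+ 2 * (i == j)%:R.
Proof.
rewrite -[LHS]/(zero_extension _ _ p) zero_extension_dom //.
set x0 := to_coord c p; have cx0 : cod c x0 by exact: to_coord_cod.
rewrite mulrfctE expr2 -mulrA; congr (_ * _).
pose h := (fun x : 'rV[R]_m => x 0 j) - cst (x0 0 j).
have hx0 : h x0 = 0 by exact: subrr.
rewrite (_ : partial i _ x0 = partial i (psi * h) x0).
  have dpsi : derivable psi x0 (delta_mx 0 i).
    by apply: diff_derivable; have [d _] := spsi 1%N; exact: d.
  have dh : derivable h x0 (delta_mx 0 i).
    apply: diff_derivable; apply: differentiableB; last exact: differentiable_cst.
    exact: differentiable_coord.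
  rewrite /partial deriveM // hx0 scale0r addr0 deriveB; last 2 first.
  - exact/diff_derivable/differentiable_coord.
  - exact: derivable_cst.
  by rewrite derive_coord derive_cst subr0 mxE eqxx /= eq_sym.
apply: near_eq_derive; near=> x.
have cx : cod c x.
  by near: x; apply: open_nbhs_nbhs; split => //; exact: cod_open.
rewrite -[LHS]/(zero_extension _ _ (of_coord c x)).
by rewrite zero_extension_dom ?of_coordK //; exact: of_coord_dom.
Unshelve. all: by end_near. Qed.

End CoordinateFields.

Section Frames.
Variables (R : realType) (m : nat) (M : smoothManifold R m).

Lemma cinf_sum (I : Type) (s : seq I) (f : I -> cinf M) (q : M) :
  (\sum_(i <- s) f i : cinf M) q = \sum_(i <- s) f i q.
Proof. exact: (big_morph (fun f : cinf M => f q)). Qed.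

Lemma tangent_fun_sum (p : M) (v : tangent p) (I : Type) (s : seq I)
    (f : I -> cinf M) :
  v (\sum_(i <- s) f i) = \sum_(i <- s) v (f i).
Proof.
have [vD vZ _] := tangentP v; apply: (big_morph v) => //.
have -> : 0 = cstf M 0 * 0 by rewrite mulr0.
by rewrite vZ mul0r.
Qed.

(** The second clause says that the E_i span T_pM, with the values on the f_i
as coordinates. *)
Definition dual_frame (p : M) (E : 'I_m -> vfield M) (f : 'I_m -> cinf M) : Prop :=
  (forall i j, E i (f j) p = (i == j)%:R) /\
  forall (v : tangent p) h, v h = \sum_i v (f i) * E i h p.

(** Multiplying the Hadamard expansion of h by the square of the bump function
gives an identity between global smooth functions, to which any derivation at
p can be applied. The resulting coefficients d_i are then identified by taking
for v the values of the damped coordinate fields themselves. *)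
Lemma exists_dual_frame (p : M) : exists E f, dual_frame p E f.
Proof.
have [c ac dp] := atlas_cover p; set x0 := to_coord c p.
have : nbhs x0 (cod c).
  by apply: open_nbhs_nbhs; split; [exact: cod_open|exact: to_coord_cod].
move=> /nbhs_ballP[r /= r0 Uc]; set U := ball x0 r in Uc.
have oU : open U by exact: ball_open.
have [psi [K [spsi psi_gt0 cK KU psi0]]] := exists_bump oU (ballxx x0 r0).
pose cut h sh := @cutoff R m M c ac psi K U spsi cK psi0 KU oU Uc h sh.
pose Y j := cut _ (smooth_centered_coord c oU p j).
pose X := cutoff_partial ac spsi cK psi0 KU oU Uc.
have s1 : smooth_on U (cst 1) by move=> k; exact: Ck_cst.
pose P := cut _ s1.
set a := psi x0 in psi_gt0.
have Pp : P p = a by rewrite /P /cut cutoff_dom // mulr1.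
have Yp j : Y j p = 0.
  by rewrite /Y /cut cutoff_dom // subrr mulr0.
have XY i j : X i (Y j) p = a ^+ 2 * (i == j)%:R by exact: cutoff_partial_coord.
have an0 : a != 0 by rewrite gt_eqF.
have taylor h : exists d : 'I_m -> R, forall v : tangent p,
    a * v h = \sum_i d i * v (Y i).
  have [d [sd hd]] := hadamard (smooth_on_chart ac Uc h).
  pose H i := cut _ (sd i); exists (fun i => d i x0) => v.
  have Hp i : H i p = a * d i x0 by rewrite /H /cut cutoff_dom.
  (* both sides vanish where psi does, so the local expansion of h suffices *)
  have hE : P * P * h = cstf M (h p) * (P * P) + \sum_i Y i * H i.
    apply: cinf_ext => q.
    rewrite -[LHS]/(P q * P q * h q).
    rewrite -[RHS]/(h p * (P q * P q) + (\sum_i Y i * H i : cinf M) q) cinf_sum.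
    have [dq|nq] := pselect (dom c q); last first.
      rewrite /P /cut cutoff_out // !mul0r mulr0 add0r big1 // => i _.
      by rewrite -[LHS]/(Y i q * H i q) /Y /cut cutoff_out // mul0r.
    under eq_bigr do rewrite -[_ q]/(Y _ q * H _ q) /Y /H /cut !cutoff_dom //.
    rewrite /P /cut cutoff_dom //; set x := to_coord c q.
    have [Ux|nUx] := pselect (U x); last first.
      have -> : psi x = 0 by apply: (psi0 x) => /KU.
      by rewrite !mul0r mulr0 add0r big1 // => i _; rewrite !mul0r.
    have := hd x Ux; rewrite /= !to_coordK // => ->.
    rewrite mulrDr mulrC; congr (_ + _); rewrite mulr_sumr; apply: eq_bigr => i _.
    by rewrite /cst; ring.
  have [vD vZ vM] := tangentP v.
  have := congr1 v hE; rewrite vM vD vZ tangent_fun_sum addrC.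
  move=> /addrI; rewrite -[(P * P : cinf M) p]/(P p * P p) Pp.
  under eq_bigr do rewrite vM Yp mul0r add0r Hp -mulrA.
  by rewrite -mulr_sumr -mulrA => /(mulfI an0).
exists X, (fun j => cstf M (a ^- 2) * Y j); split=> [i j|v h].
  have [_ XZ _] := vfieldP (X i).
  by rewrite XZ -[LHS]/(_ * X i (Y j) p) XY mulKf // expf_neq0.
have [d dE] := taylor h; apply: (mulfI an0); rewrite dE mulr_sumr.
apply: eq_bigr => i _; have [_ vZ _] := tangentP v; rewrite vZ.
have := dE (vat (X i) p); rewrite -[vat (X i) p h]/(X i h p) (bigD1 i) //= big1.
  rewrite addr0 -[vat _ _ _]/(X i (Y i) p) XY eqxx mulr1 => Xh.
  by rewrite mulrCA Xh; field.
by move=> j ji; rewrite -[vat _ _ _]/(X i (Y j) p) XY eq_sym (negbTE ji) !mulr0.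
Qed.

End Frames.

(** * Traces of operators on vector fields *)

Section Traces.
Variables (R : realType) (m : nat) (M : smoothManifold R m).
Variables (p : M) (E : 'I_m -> vfield M) (f : 'I_m -> cinf M).
Hypothesis EfP : dual_frame p E f.

Lemma dual_frame_basis : is_basis setT (fun i => vat (E i) p).
Proof.
have [Ef vE] := EfP; split=> // v' _; pose v : tangent p := v'.
exists (\row_i v (f i)); split.
  apply: tangent_ext => h; rewrite tangent_sum -[LHS]/(v h) vE; apply: eq_bigr => i _.
  by rewrite mxE.
move=> a; rewrite -/v => va; apply/rowP => j.
rewrite mxE va tangent_sum (bigD1 j) //= big1.
  by rewrite addr0 -[LHS]/(a 0 j * E j (f j) p) Ef eqxx mulr1.
by move=> i ij; rewrite -[LHS]/(a 0 i * E i (f j) p) Ef (negbTE ij) mulr0.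
Qed.

Lemma tangent_dual_frame (v : tangent p) :
  v = \sum_i v (f i) *: vat (E i) p.
Proof. by apply: tangent_ext => h; rewrite tangent_sum; exact: EfP.2. Qed.

Lemma vat_dual_frame (X : vfield M) : vat X p = \sum_i X (f i) p *: vat (E i) p.
Proof. exact: tangent_dual_frame. Qed.

Lemma is_trace_dual_frame (A : vfield M -> vfield M) (t : cinf M) :
  is_trace A t -> t p = \sum_i A (E i) (f i) p.
Proof.
move=> tA; rewrite (tA p E (\matrix_(i, j) A (E j) (f i) p)).
- by apply: eq_bigr => i _; rewrite mxE.
- exact: dual_frame_basis.
- by move=> j; rewrite vat_dual_frame; apply: eq_bigr => i _; rewrite mxE.
Qed.

Lemma trace_rank1 (w : {linear tangent p -> R^o}) (Z : vfield M) :
  \sum_i w (vat (E i) p) * Z (f i) p = w (vat Z p).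
Proof.
rewrite vat_dual_frame linear_sum; apply: eq_bigr => i _.
by rewrite linearZ /= mulrC.
Qed.

Lemma trace_rank1_form (w : oneForm M) (Z : vfield M) :
  \sum_i w (E i) p * Z (f i) p = w Z p.
Proof. exact: trace_rank1. Qed.

Lemma trace_rank1_differential (h : cinf M) (Z : vfield M) :
  \sum_i E i h p * Z (f i) p = Z h p.
Proof. by rewrite [RHS](EfP.2 (vat Z p)); apply: eq_bigr => i _; rewrite mulrC. Qed.

Lemma trace_id : \sum_i E i (f i) p = m%:R.
Proof.
by under eq_bigr do rewrite EfP.1 eqxx; rewrite sumr_const card_ord.
Qed.

(** If G is the Gram matrix and a the matrix of A, then G a is skew, so
tr a = tr (G^-1 (G a)) vanishes, G^-1 being symmetric. *)
Lemma trace_skew (g : pseudoRiemannian M) (A : vfield M -> vfield M) :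
  (forall X Y, g (A X) Y = - g X (A Y)) -> \sum_i A (E i) (f i) p = 0.
Proof.
move=> skA; pose G := \matrix_(i, j) g (E i) (E j) p.
pose a := \matrix_(i, j) A (E j) (f i) p.
have gE (X Y : vfield M) : g X Y p = metric_at g (vat X p) (vat Y p) by [].
have GT : G^T = G by apply/matrixP => i j; rewrite !mxE !gE Defs.metric_sym.
have aG i j : (G *m a) i j = g (E i) (A (E j)) p.
  rewrite [RHS]gE (vat_dual_frame (A (E j))) linear_sum mxE; apply: eq_bigr => k _.
  by rewrite !mxE linearZ /= mulrC.
have uG : G \in unitmx.
  rewrite -row_free_unit -kermx_eq0; apply/rowV0P => u /sub_kermxP uG0.
  pose v := \sum_i u 0 i *: vat (E i) p.
  have vE0 j : metric_at g v (vat (E j) p) = 0.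
    transitivity ((u *m G) 0 j); last by rewrite uG0 mxE.
    rewrite Defs.metric_sym linear_sum mxE; apply: eq_bigr => i _.
    by rewrite linearZ /= [G _ _]mxE gE Defs.metric_sym.
  have v0 : v = 0.
    apply: (@metric_nondeg _ _ _ g) => w; rewrite (tangent_dual_frame w).
    rewrite linear_sum big1 //.
    by move=> j _; rewrite linearZ /= vE0 scaler0.
  apply/rowP => j; rewrite mxE; have := congr1 (fun w : tangent p => w (f j)) v0.
  rewrite /v tangent_sum (bigD1 j) //= big1 => [|i ij].
    by rewrite addr0 -[X in X = _]/(u 0 j * E j (f j) p) EfP.1 eqxx mulr1.
  by rewrite -[LHS]/(u 0 i * E i (f j) p) EfP.1 (negbTE ij) mulr0.
have sk : (G *m a)^T = - (G *m a).
  apply/matrixP => i j; rewrite [LHS]mxE [RHS]mxE !aG.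
  rewrite -[RHS]/((- g (E i) (A (E j)) : cinf M) p).
  by rewrite -skA gE Defs.metric_sym.
have tr0 : \tr a = - \tr a.
  rewrite -{1}(mulKmx uG a) -mxtrace_tr trmx_mul sk trmx_inv GT.
  by rewrite mulNmx raddfN /= mxtrace_mulC mulKmx.
transitivity (\tr a); last by lra.
by apply: eq_bigr => i _; rewrite mxE.
Qed.

End Traces.

(** * Tensor and curvature identities *)

Section Tensors.
Variables (R : realType) (m : nat) (M : smoothManifold R m).
Implicit Types (X Y Z W : vfield M) (a f h : cinf M).

Lemma cinf_double_eq0 a : a + a = 0 -> a = 0.
Proof.
move=> a0; apply: cinf_ext => q.
have aq : a q + a q = 0 by exact: (congr1 (fun b : cinf M => b q) a0).
by rewrite -[RHS]/(0 : R); lra.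
Qed.

Lemma vfieldD_arg X f h : X (f + h) = X f + X h.
Proof. by have [] := vfieldP X. Qed.

Lemma vfieldM_arg X f h : X (f * h) = f * X h + h * X f.
Proof. by have [] := vfieldP X. Qed.

Lemma vfield1 X : X 1 = 0.
Proof.
have := vfieldM_arg X 1 1; rewrite !mul1r => /eqP.
by rewrite -subr_eq subrr => /eqP.
Qed.

Lemma vfieldB_arg X f h : X (f - h) = X f - X h.
Proof. by apply/eqP; rewrite eq_sym subr_eq -vfieldD_arg subrK. Qed.

Lemma endoD (A : endoField M) X Y : A (X + Y) = A X + A Y.
Proof.
apply: vfield_ext => f; apply: cinf_ext => p.
rewrite -[LHS]/((endo_at A p (vat (X + Y) p) : tangent p) f) vatD linearD.
by [].
Qed.

Lemma endoZ (A : endoField M) a X : A (a *: X) = a *: A X.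
Proof.
apply: vfield_ext => f; apply: cinf_ext => p.
rewrite -[LHS]/((endo_at A p (vat (a *: X) p) : tangent p) f) vatZ linearZ.
by [].
Qed.

Lemma endoN (A : endoField M) X : A (- X) = - A X.
Proof. by rewrite -scaleN1r endoZ scaleN1r. Qed.

Lemma formD (w : oneForm M) X Y : w (X + Y) = w X + w Y.
Proof.
by apply: cinf_ext => p; rewrite -[LHS]/(form_at w p (vat (X + Y) p)) vatD linearD.
Qed.

Lemma formZ (w : oneForm M) a X : w (a *: X) = a * w X.
Proof.
by apply: cinf_ext => p; rewrite -[LHS]/(form_at w p (vat (a *: X) p)) vatZ linearZ.
Qed.

Lemma formN (w : oneForm M) X : w (- X) = - w X.
Proof. by rewrite -scaleN1r formZ mulN1r. Qed.

Variable g : pseudoRiemannian M.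

Lemma metricC X Y : g X Y = g Y X.
Proof. by apply: cinf_ext => p; exact: Defs.metric_sym. Qed.

Lemma metricDr X Y Z : g X (Y + Z) = g X Y + g X Z.
Proof.
apply: cinf_ext => p.
by rewrite -[LHS]/(metric_at g (vat X p) (vat (Y + Z) p)) vatD linearD.
Qed.

Lemma metricZr a X Y : g X (a *: Y) = a * g X Y.
Proof.
apply: cinf_ext => p.
by rewrite -[LHS]/(metric_at g (vat X p) (vat (a *: Y) p)) vatZ linearZ.
Qed.

Lemma metricNr X Y : g X (- Y) = - g X Y.
Proof. by rewrite -scaleN1r metricZr mulN1r. Qed.

Lemma metricDl X Y Z : g (X + Y) Z = g X Z + g Y Z.
Proof. by rewrite metricC metricDr !(metricC Z). Qed.

Lemma metricZl a X Y : g (a *: X) Y = a * g X Y.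
Proof. by rewrite metricC metricZr (metricC Y). Qed.

Lemma metricNl X Y : g (- X) Y = - g X Y.
Proof. by rewrite metricC metricNr (metricC Y). Qed.

Lemma metric0l X : g 0 X = 0.
Proof. by rewrite -(scale0r (0 : vfield M)) metricZl mul0r. Qed.

Lemma bracketN X Y : bracket X Y = - bracket Y X.
Proof.
apply: vfield_ext => f; rewrite vfieldNE.
by rewrite -[RHS]/(- (Y (X f) - X (Y f))) opprB.
Qed.

Lemma jacobi X Y Z :
  bracket X (bracket Y Z) + bracket Y (bracket Z X) + bracket Z (bracket X Y) = 0.
Proof.
apply: vfield_ext => f; rewrite !vfieldDE.
have bE (U V : vfield M) h : bracket U V h = U (V h) - V (U h) by [].
rewrite !bE !vfieldB_arg -[RHS]/(0 : cinf M); ring.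
Qed.

End Tensors.

Section Curvature.
Variables (R : realType) (m : nat) (M : smoothManifold R m).
Variables (g : pseudoRiemannian M) (D : connection M).
Hypothesis hD : levi_civita g D.
Implicit Types (X Y Z W : vfield M) (f : cinf M).

Lemma nablaDl X X' Y : D (X + X') Y = D X Y + D X' Y.
Proof. by have := nabla_linear D 1 X X' Y; rewrite !scale1r. Qed.

Lemma nabla0l Y : D 0 Y = 0.
Proof. by apply: (addrI (D 0 Y)); rewrite -nablaDl !addr0. Qed.

Lemma nablaNl X Y : D (- X) Y = - D X Y.
Proof. by apply: (addrI (D X Y)); rewrite -nablaDl !subrr nabla0l. Qed.

Lemma nabla0r X : D X 0 = 0.
Proof. by apply: (addrI (D X 0)); rewrite -nabla_additive !addr0. Qed.

Lemma nablaNr X Y : D X (- Y) = - D X Y.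
Proof. by apply: (addrI (D X Y)); rewrite -nabla_additive !subrr nabla0r. Qed.

Lemma torsion_free X Y : bracket X Y = D X Y - D Y X.
Proof. by rewrite hD.1. Qed.

Lemma metric_compatible X Y Z : X (g Y Z) = g (D X Y) Z + g Y (D X Z).
Proof. exact: hD.2. Qed.

Lemma bianchi X Y Z :
  curvature D X Y Z + curvature D Y Z X + curvature D Z X Y = 0.
Proof.
have bE U V W : bracket U (bracket V W) =
    D U (D V W) - D U (D W V) - D (bracket V W) U.
  by rewrite torsion_free [in X in X - _]torsion_free nabla_additive nablaNr.
rewrite -[RHS](jacobi X Y Z) !bE /curvature; apply: vfield_ext => f.
rewrite !(vfieldDE, vfieldNE); ring.
Qed.

Lemma curvatureN X Y Z : curvature D X Y Z = - curvature D Y X Z.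
Proof.
rewrite /curvature (bracketN X Y) nablaNl; apply: vfield_ext => f.
rewrite !(vfieldDE, vfieldNE); ring.
Qed.

(** Compares [X,Y] g(Z,W) with X(Y g(Z,W)) - Y(X g(Z,W)), both expanded by
metric compatibility. *)
Lemma curvature_skew X Y Z W : g (curvature D X Y Z) W = - g Z (curvature D X Y W).
Proof.
have h : bracket X Y (g Z W) = X (Y (g Z W)) - Y (X (g Z W)) by [].
move: h; rewrite !metric_compatible !vfieldD_arg !metric_compatible => h.
rewrite /curvature !(metricDl, metricDr, metricNl, metricNr).
set u := g (D (bracket X Y) Z) W in h *; set v := g Z (D (bracket X Y) W) in h *.
have -> : u = u + v - v by rewrite addrK.
by rewrite h; ring.
Qed.

(** By the first Bianchi identity the difference is, up to sign, the trace of the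
skew operator R(Y,Z). *)
Lemma ricciC (Ric : vfield M -> vfield M -> cinf M) : is_ricci D Ric ->
  forall Y Z, Ric Y Z = Ric Z Y.
Proof.
move=> hRic Y Z; apply: cinf_ext => p.
have [E [f Ef]] := exists_dual_frame p.
rewrite !(is_trace_dual_frame Ef (hRic _ _)).
apply/eqP; rewrite -subr_eq0 -sumrB -oppr_eq0 -sumrN; apply/eqP.
rewrite -[RHS](trace_skew Ef (curvature_skew Y Z)); apply: eq_bigr => i _.
have := congr1 (fun V : vfield M => V (f i) p) (bianchi (E i) Y Z).
rewrite (curvatureN Z (E i)) !(vfieldDE, vfieldNE).
set u := curvature D (E i) Y Z (f i); set v := curvature D Y Z (E i) (f i).
set w := curvature D (E i) Z Y (f i).
rewrite -[X in X = _]/(u p + v p - w p) -[X in _ = X]/(0 : R); lra.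
Qed.

End Curvature.

(** * Trans-para-Sasakian manifolds *)

Section TransParaSasakian.
Variables (R : realType) (n : nat) (M : smoothManifold R (2 * n).+1).
Variables (phi : endoField M) (xi : vfield M) (eta : oneForm M).
Variables (g : pseudoRiemannian M) (D : connection M) (alpha beta : cinf M).
Hypothesis hpc : almost_paracontact_metric phi xi eta g.
Hypothesis hD : levi_civita g D.
Hypothesis htps : trans_para_sasakian phi xi eta g D alpha beta.
Implicit Types (X Y Z W : vfield M) (f : cinf M).

Let phi_xi : phi xi = 0 := apm_phi_xi hpc.
Let eta_phi X : eta (phi X) = 0 := apm_eta_phi hpc X.
Let eta_xi : eta xi = 1 := apm_eta_xi hpc.
Let phi2 X : phi (phi X) = X - eta X *: xi := apm_phi2 hpc X.

Lemma metric_xi X : g X xi = eta X.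
Proof.
have := apm_compat hpc X xi; rewrite phi_xi metricC metric0l eta_xi mulr1.
by move=> /esym/eqP; rewrite addrC subr_eq0 => /eqP.
Qed.

Lemma phi_skew X Y : g (phi X) Y = - g X (phi Y).
Proof.
have := apm_compat hpc X (phi Y); rewrite phi2 metricDr metricNr metricZr metric_xi.
by rewrite !eta_phi !mulr0 subr0 addr0.
Qed.

Lemma metric_phi_sym X Y : g Y (phi X) = - g X (phi Y).
Proof. by rewrite metricC phi_skew. Qed.

(** Apply phi to the defining equation at Y = xi; phi^2 loses the xi-component,
which is zero because g(xi,xi) is constant. *)
Lemma nabla_xi X :
  D X xi = - (alpha *: phi X) - beta *: X + (beta * eta X) *: xi.
Proof.
have eta_nabla : eta (D X xi) = 0.
  apply: cinf_double_eq0; rewrite -metric_xi {2}metricC -(metric_compatible hD).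
  by rewrite metric_xi eta_xi vfield1.
have := congr1 phi (htps X xi); rewrite phi_xi nabla0r sub0r endoN phi2 eta_nabla.
rewrite scale0r subr0 metric_xi eta_xi !(endoD, endoZ) phi_xi phi2.
rewrite metricC metric0l scale0r add0r !scaler0 add0r !scale1r => h.
rewrite -[LHS]opprK h; apply: vfield_ext => f.
rewrite !(vfieldDE, vfieldNE, vfieldZE); ring.
Qed.

Lemma nabla_phi X Y : D X (phi Y) = phi (D X Y) +
  (alpha *: (- g X Y *: xi + eta Y *: X) +
   beta *: (g X (phi Y) *: xi + eta Y *: phi X)).
Proof. by rewrite -htps addrC subrK. Qed.

Lemma nabla_eta X Y : X (eta Y) =
  eta (D X Y) - alpha * g Y (phi X) - beta * g X Y + beta * eta X * eta Y.
Proof.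
rewrite -!metric_xi (metric_compatible hD) nabla_xi.
rewrite !(metricDr, metricNr, metricZr) !metric_xi (metricC _ Y X); ring.
Qed.

(** The two contributions to the coefficient of g(X, phi Y) xi, from the
derivative of phi and from the exterior derivative of eta, cancel. *)
Lemma curvature_xi X Y : curvature D X Y xi =
  - ((alpha * alpha + beta * beta) *: (eta Y *: X - eta X *: Y))
  - ((alpha * beta + alpha * beta) *: (eta Y *: phi X - eta X *: phi Y))
  - X alpha *: phi Y + Y alpha *: phi X
  + Y beta *: (X - eta X *: xi) - X beta *: (Y - eta Y *: xi).
Proof.
rewrite /curvature (nabla_xi X) (nabla_xi Y) (nabla_xi (bracket X Y)).
rewrite (torsion_free hD) !(nabla_additive, nablaNr, nabla_leibniz).
rewrite !nabla_phi !vfieldM_arg !nabla_eta (nabla_xi X) (nabla_xi Y).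
rewrite !(endoD, endoN, formD, formN).
rewrite (metric_phi_sym X Y) (metricC g Y X).
apply: vfield_ext => f; rewrite !(vfieldDE, vfieldNE, vfieldZE).
move: (X alpha) (Y alpha) (X beta) (Y beta) (eta X) (eta Y) (g X Y).
move: (g X (phi Y)) (phi (D X Y) f) (phi (D Y X) f) (D X Y f) (D Y X f).
move: (phi X f) (phi Y f) (X f) (Y f) (xi f) (eta (D X Y)) (eta (D Y X)) => *.
ring.
Qed.

Lemma curvature_xi_xi X : curvature D X xi xi =
  (- (alpha * alpha + beta * beta) + xi beta) *: (X - eta X *: xi)
  + (xi alpha - (alpha * beta + alpha * beta)) *: phi X.
Proof.
rewrite curvature_xi phi_xi eta_xi; apply: vfield_ext => f.
rewrite !(vfieldDE, vfieldNE, vfieldZE) -[(0 : vfield M) f]/(0 : cinf M); ring.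
Qed.


Variables (Ric : vfield M -> vfield M -> cinf M).
Hypothesis hRic : is_ricci D Ric.

(** Each term of R(X,Y)xi is, as an endomorphism in X, the identity, a multiple
of phi, which is traceless because it is g-skew, or of rank one. *)
Lemma ricci_xi Y : Ric Y xi =
  cstf M (2 * n%:R) * (Y beta - (alpha * alpha + beta * beta) * eta Y)
  - phi Y alpha - Y beta + eta Y * xi beta.
Proof.
apply: cinf_ext => p; have [E [f Ef]] := exists_dual_frame p.
rewrite (is_trace_dual_frame Ef (@hRic Y xi)).
pose c := alpha p * alpha p + beta p * beta p; pose d := alpha p * beta p *+ 2.
have T i : curvature D (E i) Y xi (f i) p =
    (Y beta p - c * eta Y p) * E i (f i) p + c * (eta (E i) p * Y (f i) p)
    + (Y alpha p - d * eta Y p) * phi (E i) (f i) p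
    + d * (eta (E i) p * phi Y (f i) p)
    - E i alpha p * phi Y (f i) p - Y beta p * (eta (E i) p * xi (f i) p)
    - E i beta p * Y (f i) p + eta Y p * (E i beta p * xi (f i) p).
  rewrite curvature_xi -[LHS]/(
    - (c * (eta Y p * E i (f i) p - eta (E i) p * Y (f i) p))
    - (alpha p * beta p + alpha p * beta p) *
      (eta Y p * phi (E i) (f i) p - eta (E i) p * phi Y (f i) p)
    - E i alpha p * phi Y (f i) p + Y alpha p * phi (E i) (f i) p
    + Y beta p * (E i (f i) p - eta (E i) p * xi (f i) p)
    - E i beta p * (Y (f i) p - eta Y p * xi (f i) p)).
  rewrite /d; move: c (alpha p) (beta p) (Y alpha p) (Y beta p) (eta Y p).
  move: (eta (E i) p) (E i (f i) p) (E i alpha p) (E i beta p) (Y (f i) p).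
  move: (phi (E i) (f i) p) (phi Y (f i) p) (xi (f i) p) => *.
  ring.
under eq_bigr do rewrite T.
rewrite !(big_split, sumrN) /= -!mulr_sumr (trace_id Ef) (trace_skew Ef phi_skew).
rewrite !(trace_rank1_form Ef) !(trace_rank1_differential Ef).
rewrite eta_phi eta_xi -[(0 : cinf M) p]/(0 : R) -[(1 : cinf M) p]/(1 : R).
rewrite -[RHS]/(2 * n%:R * (Y beta p - c * eta Y p) - phi Y alpha p - Y beta p
  + eta Y p * xi beta p).
have -> : (2 * n).+1%:R = 2 * n%:R + 1 :> R by rewrite -addn1 natrD natrM.
clear T; move: c d (Y alpha p) (Y beta p) (eta Y p) (phi Y alpha p) (xi beta p) => *.
ring.
Qed.

Variables (ga gb : vfield M).
Hypotheses (hga : is_gradient g alpha ga) (hgb : is_gradient g beta gb).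
Hypothesis hgrad : phi ga = - (cstf M (2 * n%:R - 1) *: gb).

Lemma ricci_xi_eta Y : Ric Y xi =
  (xi beta - cstf M (2 * n%:R) * (alpha * alpha + beta * beta)) * eta Y.
Proof.
have phiYa : phi Y alpha = cstf M (2 * n%:R - 1) * Y beta.
  rewrite -hga -[g ga _]opprK -phi_skew hgrad metricNl metricZl hgb; exact: opprK.
rewrite ricci_xi phiYa.
have -> : cstf M (2 * n%:R - 1) = cstf M (2 * n%:R) - 1 by exact: cinf_ext.
ring.
Qed.

End TransParaSasakian.

Theorem theorem3p8 (R : realType) (n : nat) (hn : (1 <= n)%N)
    (M : smoothManifold R (2 * n).+1)
    (phi : endoField M) (xi : vfield M) (eta : oneForm M) (g : pseudoRiemannian M)
    (hpc : almost_paracontact_metric phi xi eta g)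
    (D : connection M) (hD : levi_civita g D)
    (alpha beta : cinf M)
    (htps : trans_para_sasakian phi xi eta g D alpha beta)
    (grad_alpha grad_beta : vfield M)
    (hga : is_gradient g alpha grad_alpha)
    (hgb : is_gradient g beta grad_beta)
    (hgrad : phi grad_alpha = - (cstf M (2 * n%:R - 1) *: grad_beta))
    (Ric : vfield M -> vfield M -> cinf M) (hRic : is_ricci D Ric)
    (Q : vfield M -> vfield M) (hQ : is_ricci_operator g Ric Q)
    (scal : cinf M) (hscal : is_metric_trace g Ric scal)
    (hflat : forall X Y Z, weyl g D Ric Q scal X Y Z = 0) :
  eta_einstein eta g Ric.
Proof.
have RicC := ricciC hD hRic.
have Ricxi := ricci_xi_eta hpc hD htps hRic hga hgb hgrad.
have g_xi := metric_xi hpc; have eta_xi := apm_eta_xi hpc.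
set k := xi beta - _ in Ricxi.
pose c := cstf M (2 * n%:R - 1); pose c' := cstf M (2 * n%:R - 1)^-1.
have x0 : 2 * n%:R - 1 != 0 :> R.
  have n1 : (1 : R) <= n%:R by rewrite ler1n.
  by rewrite gt_eqF // subr_gt0; lra.
have cc' : c * c' = 1 by apply: cinf_ext => p; exact: divff x0.
pose s := cstf M (2 * n%:R * (2 * n%:R - 1))^-1 * scal.
pose l := xi beta - (alpha * alpha + beta * beta).
pose t := xi alpha - (alpha * beta + alpha * beta).
have RicE X Y : Ric X Y = (c * (l + s) - k) * g X Y
    + (k + k - c * (l + s)) * (eta X * eta Y) + c * t * g (phi X) Y.
  (* C(X,xi)xi = 0, paired with Y and scaled so that Ric X Y has coefficient 1 *)
  have := congr1 (fun V : vfield M => c * g V Y) (hflat X xi xi).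
  rewrite /weyl (curvature_xi_xi hpc hD htps) -/c' -/s.
  rewrite !(metricDl, metricNl, metricZl) -!hQ metric0l mulr0.
  rewrite (RicC xi Y) !Ricxi (metricC g xi Y) !g_xi eta_xi -/t.
  set H := (X in X = 0) => H0; apply/eqP; rewrite -subr_eq0; apply/eqP.
  transitivity ((1 - c * c') *
      (Ric X Y + k * g X Y - (k + k) * (eta X * eta Y)) - H).
    rewrite /H /l; clear H H0 RicC Ricxi cc'.
    move: (Ric X Y) (g X Y) (eta X) (eta Y) (g (phi X) Y) (xi beta) => *.
    move: k c c' s t => *.
    ring.
  by rewrite H0 cc' subrr mul0r subr0.
(* the other terms of RicE are symmetric in X and Y, and this one is skew *)
have skew0 X Y : c * t * g (phi X) Y = 0.
  have := RicC X Y; rewrite !RicE (metricC g Y X) (phi_skew hpc Y X) (metricC g Y).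
  rewrite [eta Y * _]mulrC => /addrI h; apply: cinf_double_eq0.
  by rewrite {1}h mulrN addNr.
exists (c * (l + s) - k), (k + k - c * (l + s)) => X Y.
by rewrite RicE skew0 addr0.
Qed.
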